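(* For every bounded linear operator $T\in B(c_0,\ell_1)$, $$\lim_{k\to\infty}\sqrt k\,x_k(T)=\lim_{k\to\infty}\sqrt k\,y_k(T)=\lim_{k\to\infty}k\,h_k(T)=0.$$
   Context: For Banach spaces $X,Y$, $T\in B(X,Y)$ (bounded linear operators) and $n\in\mathbb N$ ($n\ge1$) define: - approximation numbers $a_n(T)=\inf\{\|T-S\|: S\in B(X,Y),\ \mathrm{rank}\,S<n\}$; - Weyl numbers $x_n(T)=\sup\{a_n(Tu): u:\ell_2\to X,\ \|u\|\leq 1\}$; - Chang numbers $y_n(T)=\sup\{a_n(vT): v:Y\to\ell_2,\ \|v\|\leq 1\}$; - Hilbert numbers $h_n(T)=\sup\{a_n(vTu): u:\ell_2\to X,\ v:Y\to\ell_2,\ \|u\|\,\|v\|\leq 1\}$. *)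

(* Defs.v *)
From HB Require Import structures.
From mathcomp Require Import all_boot all_order all_algebra.
From mathcomp Require Import ring.
From mathcomp Require Import complex.
From mathcomp Require Import boolp classical_sets functions reals topology.
From mathcomp Require Import normedtype sequences.

Set Implicit Arguments.
Unset Strict Implicit.
Unset Printing Implicit Defensive.

Import Order.TTheory GRing.Theory Num.Theory.
Import numFieldNormedType.Exports.
Local Open Scope classical_set_scope.
Local Open Scope ring_scope.

(* Banach spaces are real or complex.  The norm of a normed module over
   [scalars R s] takes its values in [scalars R s]; [rnorm] is the same norm,
   read in [R], where suprema, infima and square roots are available. *)
Variant scalar_kind := RealScalars | ComplexScalars.

Definition scalars (R : realType) (s : scalar_kind) : numFieldType :=
  match s with RealScalars => R | ComplexScalars => (R[i])%C end.

Definition scalar_re (R : realType) (s : scalar_kind) : scalars R s -> R :=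
  match s with
  | RealScalars => fun x : R => x
  | ComplexScalars => fun z : (R[i])%C => complex.Re z
  end.

Definition scalar_of (R : realType) (s : scalar_kind) : R -> scalars R s :=
  match s with
  | RealScalars => fun x : R => x
  | ComplexScalars => fun x : R => (x%:C)%C
  end.

Definition rnorm (R : realType) (s : scalar_kind)
    (V : normedZmodType (scalars R s)) (x : V) : R := scalar_re `|x|.

Section ScalarTheory.
Context {R : realType} {s : scalar_kind}.
Implicit Type V : normedZmodType (scalars R s).

Lemma scalar_ofK (a : R) : scalar_re (scalar_of s a) = a.
Proof. by case: s. Qed.

Lemma scalar_of0 : scalar_of s (0 : R) = 0.
Proof. by case: s. Qed.

Lemma scalar_ofD (a b : R) :
  scalar_of s (a + b) = scalar_of s a + scalar_of s b.
Proof. by case: s => //=; rewrite rmorphD. Qed.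

Lemma scalar_ofM (a b : R) :
  scalar_of s (a * b) = scalar_of s a * scalar_of s b.
Proof. by case: s => //=; rewrite rmorphM. Qed.

Lemma ler_scalar_of (a b : R) : (scalar_of s a <= scalar_of s b) = (a <= b).
Proof. by case: s => //=; rewrite lecR. Qed.

Lemma scalar_reK (z : scalars R s) : 0 <= z -> scalar_of s (scalar_re z) = z.
Proof. by case: s z => //= z z0; rewrite RRe_real// ger0_real. Qed.

Lemma rnormE V (x : V) : `|x| = scalar_of s (rnorm x).
Proof. by rewrite scalar_reK. Qed.

Lemma rnorm_ge0 V (x : V) : 0 <= rnorm x.
Proof. by rewrite -ler_scalar_of scalar_of0 -rnormE. Qed.

Lemma rnorm0 V : rnorm (0 : V) = 0.
Proof. by rewrite /rnorm normr0 -scalar_of0 scalar_ofK. Qed.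

Lemma rnorm_eq0 V (x : V) : rnorm x = 0 -> x = 0.
Proof. by move=> x0; apply: normr0_eq0; rewrite rnormE x0 scalar_of0. Qed.

Lemma rnormN V (x : V) : rnorm (- x) = rnorm x.
Proof. by rewrite /rnorm normrN. Qed.

Lemma ler_rnormD V (x y : V) : rnorm (x + y) <= rnorm x + rnorm y.
Proof. by rewrite -ler_scalar_of scalar_ofD -!rnormE ler_normD. Qed.

Lemma rnormM (a b : scalars R s) : rnorm (a * b) = rnorm a * rnorm b.
Proof.
by apply: (can_inj scalar_ofK); rewrite scalar_ofM -!rnormE normrM.
Qed.

Lemma rnormZ (V : normedModType (scalars R s)) (a : scalars R s) (x : V) :
  rnorm (a *: x) = rnorm a * rnorm x.
Proof.
by apply: (can_inj scalar_ofK); rewrite scalar_ofM -!rnormE normrZ.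
Qed.

End ScalarTheory.

Section SequenceSpaces.
Context (R : realType) (s : scalar_kind).
Local Notation K := (scalars R s).
Implicit Types x y : nat -> K.

Definition c0_pred : {pred nat -> K} := mem [set x | x @ \oo --> (0 : K)].

Definition l1_pred : {pred nat -> K} :=
  mem [set x | cvgn (series (fun n => rnorm (x n)))].

Definition l2_pred : {pred nat -> K} :=
  mem [set x | cvgn (series (fun n => rnorm (x n) ^+ 2))].

Definition c0_norm x : R := sup (range (fun n => rnorm (x n))).

Definition l1_norm x : R := limn (series (fun n => rnorm (x n))).

Definition l2_norm x : R := Num.sqrt (limn (series (fun n => rnorm (x n) ^+ 2))).

Lemma nonneg_series_ub (u : nat -> R) (M : R) : (forall n, 0 <= u n) ->
  (forall n, series u n <= M) -> cvgn (series u) /\ limn (series u) <= M.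
Proof.
move=> u0 uM.
have cu : cvgn (series u).
  apply: nondecreasing_is_cvgn; first exact: nondecreasing_series.
  by exists M => _ [n _ <-].
by split=> //; apply: limr_le => //; apply: nearW.
Qed.

Lemma nonneg_series_le_lim (u : nat -> R) n : (forall n, 0 <= u n) ->
  cvgn (series u) -> series u n <= limn (series u).
Proof.
move=> u0 cu; apply: nondecreasing_cvgn_le => //.
exact: nondecreasing_series.
Qed.

Lemma nonneg_series_term_le_lim (u : nat -> R) n : (forall n, 0 <= u n) ->
  cvgn (series u) -> u n <= limn (series u).
Proof.
move=> u0 cu; apply: le_trans (nonneg_series_le_lim n.+1 u0 cu).
by rewrite seriesSr lerDr /series /= sumr_ge0.
Qed.

Lemma c0_submod_closed : submod_closed c0_pred.
Proof.
split; first by rewrite inE; exact: cvg_cst.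
move=> a x y; rewrite !inE /= => x0 y0.
by rewrite -[0](addr0 (0 : K)) -{1}[0](mulr0 a); apply: cvgD => //; apply: cvgM => //; exact: cvg_cst.
Qed.

Lemma c0_rnorm_has_sup x : x \in c0_pred ->
  has_sup (range (fun n => rnorm (x n))).
Proof.
rewrite inE /= => x0; split; first by exists (rnorm (x 0%N)), 0%N.
have /cvgr0Pnorm_lt/(_ 1 ltr01)[N _ xN] := x0.
exists (1 + \sum_(i < N) rnorm (x i)) => _ [n _ <-].
have sum0 : 0 <= \sum_(i < N) rnorm (x i) by apply: sumr_ge0 => i _; exact: rnorm_ge0.
have [Nn|nN] := leqP N n.
  apply: ler_wpDr => //; rewrite -(@ler_scalar_of R s) -rnormE.
  have -> : scalar_of s (1 : R) = 1 by case: (s) => //=.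
  exact/ltW/xN.
rewrite (bigD1 (Ordinal nN)) //= addrCA lerDl addr_ge0 // sumr_ge0 // => i _.
exact: rnorm_ge0.
Qed.

Lemma c0_norm_ub x n : x \in c0_pred -> rnorm (x n) <= c0_norm x.
Proof.
by move=> xc; apply: sup_upper_bound; [exact: c0_rnorm_has_sup|exists n].
Qed.

Lemma c0_norm_le x (M : R) : (forall n, rnorm (x n) <= M) -> c0_norm x <= M.
Proof.
by move=> xM; apply: ge_sup; [exists (rnorm (x 0%N)), 0%N|move=> _ [n _ <-]].
Qed.

Lemma l1_submod_closed : submod_closed l1_pred.
Proof.
split.
  rewrite inE /=.
  rewrite (_ : (fun _ => _) = (fun=> 0)); last first.
    by apply/funext => n; rewrite rnorm0.
  by apply: (nonneg_series_ub (M := 0) _ _).1 => // n; rewrite /series /= big1.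
move=> a x y; rewrite !inE /= => cx cy.
apply: (nonneg_series_ub (M := rnorm a * l1_norm x + l1_norm y) _ _).1.
  by move=> n; exact: rnorm_ge0.
move=> n; apply: (@le_trans _ _ (\sum_(0 <= i < n)
  (rnorm a * rnorm (x i) + rnorm (y i)))).
  by apply: ler_sum => i _; rewrite (le_trans (ler_rnormD _ _)) // rnormM.
rewrite big_split /= -mulr_sumr lerD ?ler_wpM2l ?rnorm_ge0 //;
  by apply: nonneg_series_le_lim => // i; exact: rnorm_ge0.
Qed.

Lemma l2_sum_le (A B : R) x y n : 0 <= A -> 0 <= B ->
  (forall n, series (fun i => rnorm (x i) ^+ 2) n <= A ^+ 2) ->
  (forall n, series (fun i => rnorm (y i) ^+ 2) n <= B ^+ 2) ->
  series (fun i => rnorm (x i + y i) ^+ 2) n <= (A + B) ^+ 2.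
Proof.
have zero (z : nat -> K) :
    (forall n, series (fun i => rnorm (z i) ^+ 2) n <= 0 ^+ 2) -> forall i, z i = 0.
  move=> z0 i; apply: rnorm_eq0; apply/eqP; rewrite -sqrf_eq0 eq_le sqr_ge0 andbT.
  rewrite expr0n /= in z0; apply: le_trans (z0 i.+1).
  by rewrite seriesSr lerDr /series /= sumr_ge0 // => j _; rewrite sqr_ge0.
move=> A0 B0 xA yB.
have [A00|An0] := eqVneq A 0.
  rewrite A00 add0r; apply: le_trans (yB n); apply: ler_sum => i _.
  by rewrite zero ?add0r // -A00.
have [B00|Bn0] := eqVneq B 0.
  rewrite B00 addr0; apply: le_trans (xA n); apply: ler_sum => i _.
  by rewrite (zero y) ?addr0 // -B00.
have Ap : 0 < A by rewrite lt_neqAle eq_sym An0.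
have Bp : 0 < B by rewrite lt_neqAle eq_sym Bn0.
apply: (@le_trans _ _ (\sum_(0 <= i < n)
    ((1 + B / A) * rnorm (x i) ^+ 2 + (1 + A / B) * rnorm (y i) ^+ 2))).
  apply: ler_sum => i _.
  apply: (@le_trans _ _ ((rnorm (x i) + rnorm (y i)) ^+ 2)).
    by rewrite ler_sqr ?nnegrE ?addr_ge0 ?rnorm_ge0 // ler_rnormD.
  move: (rnorm (x i)) (rnorm (y i)) => p q.
  rewrite -subr_ge0.
  have -> : (1 + B / A) * p ^+ 2 + (1 + A / B) * q ^+ 2 - (p + q) ^+ 2 =
            (B * p - A * q) ^+ 2 / (A * B).
    by field; rewrite An0 Bn0.
  by rewrite divr_ge0 ?sqr_ge0 // mulr_ge0.
rewrite big_split /= -!mulr_sumr.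
apply: (@le_trans _ _ ((1 + B / A) * A ^+ 2 + (1 + A / B) * B ^+ 2)).
  rewrite lerD // ler_wpM2l ?addr_ge0 ?divr_ge0 //; [exact: xA|exact: yB].
rewrite le_eqVlt; apply/orP; left; apply/eqP; field.
by rewrite An0 Bn0.
Qed.

Lemma l2_pred_le x (M : R) : 0 <= M ->
  (forall n, series (fun i => rnorm (x i) ^+ 2) n <= M ^+ 2) ->
  x \in l2_pred /\ l2_norm x <= M.
Proof.
move=> M0 xM; have [cx lx] := nonneg_series_ub (fun i => sqr_ge0 (rnorm (x i))) xM.
split; first by rewrite inE.
by rewrite -[leRHS]ger0_norm // -sqrtr_sqr ler_wsqrtr.
Qed.

Lemma l2_norm_ub x n : x \in l2_pred ->
  series (fun i => rnorm (x i) ^+ 2) n <= l2_norm x ^+ 2.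
Proof.
rewrite inE /= => cx; have := nonneg_series_le_lim n (fun i => sqr_ge0 (rnorm (x i))) cx.
move=> h; rewrite sqr_sqrtr //; apply: le_trans h.
by apply: sumr_ge0 => i _; exact: sqr_ge0.
Qed.

Lemma l2_normD_subproof x y : x \in l2_pred -> y \in l2_pred ->
  x + y \in l2_pred /\ l2_norm (x + y) <= l2_norm x + l2_norm y.
Proof.
move=> xl yl; apply: l2_pred_le => [|n]; first by rewrite addr_ge0 ?sqrtr_ge0.
by apply: l2_sum_le => [||m|m]; rewrite ?sqrtr_ge0 ?l2_norm_ub.
Qed.

Lemma series_rnormZ2 a x :
  series (fun i => rnorm ((a *: x) i) ^+ 2) =
  (fun n => rnorm a ^+ 2 * series (fun i => rnorm (x i) ^+ 2) n).
Proof.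
apply/funext => n; rewrite /series /= mulr_sumr; apply: eq_bigr => i _.
by rewrite rnormM exprMn.
Qed.

Lemma l2_submod_closed : submod_closed l2_pred.
Proof.
split.
  apply: (@l2_pred_le _ 0 _ _).1 => // n.
  by rewrite expr0n /series /= big1 // => i _; rewrite rnorm0 expr0n.
move=> a x y xl yl; apply: (l2_normD_subproof _ yl).1.
rewrite inE /= series_rnormZ2; apply: cvgP; apply: cvgM; first exact: cvg_cst.
by rewrite inE in xl; exact: xl.
Qed.

HB.instance Definition _ :=
  GRing.isSubmodClosed.Build K (nat -> K) c0_pred c0_submod_closed.
HB.instance Definition _ :=
  GRing.isSubmodClosed.Build K (nat -> K) l1_pred l1_submod_closed.
HB.instance Definition _ :=
  GRing.isSubmodClosed.Build K (nat -> K) l2_pred l2_submod_closed.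

Record c0 := C0 { c0_val :> nat -> K; c0_valP : c0_val \in c0_pred }.
Record l1 := L1 { l1_val :> nat -> K; l1_valP : l1_val \in l1_pred }.
Record l2 := L2 { l2_val :> nat -> K; l2_valP : l2_val \in l2_pred }.

HB.instance Definition _ := [isSub for c0_val].
HB.instance Definition _ := [Choice of c0 by <:].
HB.instance Definition _ := [SubChoice_isSubLmodule of c0 by <:].

HB.instance Definition _ := [isSub for l1_val].
HB.instance Definition _ := [Choice of l1 by <:].
HB.instance Definition _ := [SubChoice_isSubLmodule of l1 by <:].

HB.instance Definition _ := [isSub for l2_val].
HB.instance Definition _ := [Choice of l2 by <:].
HB.instance Definition _ := [SubChoice_isSubLmodule of l2 by <:].

Lemma c0_normD (x y : c0) : c0_norm (x + y : c0) <= c0_norm x + c0_norm y.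
Proof.
apply: c0_norm_le => n; apply: le_trans (ler_rnormD _ _) _.
by rewrite lerD ?c0_norm_ub ?c0_valP.
Qed.

Lemma c0_norm_eq0 (x : c0) : c0_norm x = 0 -> x = 0.
Proof.
move=> x0; apply: val_inj; apply/funext => n; apply: rnorm_eq0; apply/eqP.
by rewrite eq_le rnorm_ge0 -x0 c0_norm_ub ?c0_valP.
Qed.

Lemma c0_normZ a (x : c0) : c0_norm (a *: x : c0) = rnorm a * c0_norm x.
Proof.
have le (b : K) (y : c0) : c0_norm (b *: y : c0) <= rnorm b * c0_norm y.
  apply: c0_norm_le => n.
  by rewrite [rnorm _](rnormM b) ler_wpM2l ?rnorm_ge0 ?c0_norm_ub ?c0_valP.
apply/eqP; rewrite eq_le le /=.
have [->|a0] := eqVneq a 0.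
  rewrite rnorm0 mul0r; apply: le_trans (rnorm_ge0 ((0 *: x : c0) 0%N)) _.
  exact/c0_norm_ub/c0_valP.
have ra0 : 0 < rnorm a.
  by rewrite lt_neqAle rnorm_ge0 andbT eq_sym; apply: contra_neq a0; exact: rnorm_eq0.
have := le a^-1 (a *: x); rewrite scalerA mulVf // scale1r.
rewrite -(ler_pM2l ra0) mulrA -rnormM mulfV //.
suff -> : rnorm (1 : K) = 1 by rewrite mul1r.
by rewrite /rnorm normr1; case: (s).
Qed.

Lemma l1_normD (x y : l1) : l1_norm (x + y : l1) <= l1_norm x + l1_norm y.
Proof.
have [] := (valP x, valP y); rewrite !inE /= => cx cy.
apply: (nonneg_series_ub _ _).2 => n; first exact: rnorm_ge0.
apply: (@le_trans _ _ (\sum_(0 <= i < n) (rnorm (x i) + rnorm (y i)))).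
  by apply: ler_sum => i _; exact: ler_rnormD.
by rewrite big_split /= lerD //; apply: nonneg_series_le_lim => // i;
  exact: rnorm_ge0.
Qed.

Lemma l1_norm_eq0 (x : l1) : l1_norm x = 0 -> x = 0.
Proof.
have := valP x; rewrite inE /= => cx x0.
apply: val_inj; apply/funext => n; apply: rnorm_eq0; apply/eqP.
rewrite eq_le rnorm_ge0 -x0.
by rewrite (nonneg_series_term_le_lim n (fun i => rnorm_ge0 (x i)) cx).
Qed.

Lemma l1_normZ a (x : l1) : l1_norm (a *: x : l1) = rnorm a * l1_norm x.
Proof.
have := valP x; rewrite inE /= => cx.
rewrite /l1_norm; set u := series _.
have -> : u = (fun n => rnorm a * series (fun i => rnorm (x i)) n).
  apply/funext => n; rewrite /u /series /= mulr_sumr; apply: eq_bigr => i _.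
  exact: rnormM.
by apply/cvg_lim => //; apply: cvgM => //; exact: cvg_cst.
Qed.

Lemma l2_normD (x y : l2) : l2_norm (x + y : l2) <= l2_norm x + l2_norm y.
Proof. exact: (l2_normD_subproof (l2_valP x) (l2_valP y)).2. Qed.

Lemma l2_norm_eq0 (x : l2) : l2_norm x = 0 -> x = 0.
Proof.
move=> x0; apply: val_inj; apply/funext => n; apply: rnorm_eq0.
apply/eqP; rewrite -sqrf_eq0 eq_le sqr_ge0 andbT.
have := l2_norm_ub n.+1 (l2_valP x); rewrite x0 expr0n; apply: le_trans.
by rewrite seriesSr lerDr /series /= sumr_ge0 // => i _; rewrite sqr_ge0.
Qed.

Lemma l2_normZ a (x : l2) : l2_norm (a *: x : l2) = rnorm a * l2_norm x.
Proof.
have := valP x; rewrite inE /= => cx.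
rewrite -[rnorm a]ger0_norm ?rnorm_ge0 // -sqrtr_sqr -sqrtrM ?sqr_ge0 //.
congr (Num.sqrt _); rewrite [X in limn X]series_rnormZ2.
by apply/cvg_lim => //; apply: cvgM => //; exact: cvg_cst.
Qed.

End SequenceSpaces.

Section SequenceSpacesNormed.
Context (R : realType) (s : scalar_kind).
Local Notation K := (scalars R s).

Let norm_D (E : zmodType) (N : E -> R) :
  (forall x y, N (x + y) <= N x + N y) ->
  forall x y, scalar_of s (N (x + y)) <= scalar_of s (N x) + scalar_of s (N y).
Proof. by move=> ND x y; rewrite -scalar_ofD ler_scalar_of. Qed.

Let norm_Z (E : lmodType K) (N : E -> R) :
  (forall a x, N (a *: x) = rnorm a * N x) ->
  forall (a : K) (x : E), scalar_of s (N (a *: x)) = `|a| * scalar_of s (N x).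
Proof. by move=> NZ a x; rewrite NZ scalar_ofM rnormE. Qed.

Let norm_0 (E : zmodType) (N : E -> R) : (forall x, N x = 0 -> x = 0) ->
  forall x, scalar_of s (N x) = 0 -> x = 0.
Proof.
by move=> N0 x /(congr1 (@scalar_re R s)); rewrite -scalar_of0 !scalar_ofK => /N0.
Qed.

HB.instance Definition _ := Lmodule_isNormed.Build K (c0 R s)
  (norm_D (@c0_normD R s)) (norm_Z (@c0_normZ R s)) (norm_0 (@c0_norm_eq0 R s)).
HB.instance Definition _ := Lmodule_isNormed.Build K (l1 R s)
  (norm_D (@l1_normD R s)) (norm_Z (@l1_normZ R s)) (norm_0 (@l1_norm_eq0 R s)).
HB.instance Definition _ := Lmodule_isNormed.Build K (l2 R s)
  (norm_D (@l2_normD R s)) (norm_Z (@l2_normZ R s)) (norm_0 (@l2_norm_eq0 R s)).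

Lemma rnorm_c0 (x : c0 R s) : rnorm x = c0_norm x.
Proof. exact: scalar_ofK. Qed.

Lemma rnorm_l1 (x : l1 R s) : rnorm x = l1_norm x.
Proof. exact: scalar_ofK. Qed.

Lemma rnorm_l2 (x : l2 R s) : rnorm x = l2_norm x.
Proof. exact: scalar_ofK. Qed.

End SequenceSpacesNormed.

Section Operators.
Context {R : realType} {s : scalar_kind}.
Local Notation K := (scalars R s).
Implicit Types X Y Z : normedModType K.

Definition bounded_op X Y (T : X -> Y) : Prop :=
  exists M : R, forall x, rnorm (T x) <= M * rnorm x.

(* [sup] of an unbounded set is 0, so [opnorm] is only meaningful for bounded
   operators; every use below comes with a [bounded_op] hypothesis. *)
Definition opnorm X Y (T : X -> Y) : R :=
  sup [set rnorm (T x) | x in [set x | rnorm x <= 1]].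

Definition lin_indep Y (m : nat) (e : 'I_m -> Y) : Prop :=
  forall c : 'I_m -> K, \sum_(i < m) c i *: e i = 0 -> forall i, c i = 0.

(* [has_rank T m]: the range of T has a basis with m elements. *)
Definition has_rank X Y (T : X -> Y) (m : nat) : Prop :=
  exists e : 'I_m -> Y, lin_indep e /\
    range T = range (fun c : 'I_m -> K => \sum_(i < m) c i *: e i).

Definition rank_lt X Y (T : X -> Y) (n : nat) : Prop :=
  exists2 m, (m < n)%N & has_rank T m.

Definition approx_set X Y (n : nat) (T : X -> Y) : set R :=
  [set opnorm (T \- S) | S in [set S : {linear X -> Y} |
    bounded_op S /\ rank_lt S n]].

Definition approx X Y (n : nat) (T : X -> Y) : R := inf (approx_set n T).

Definition weyl_set X Y (n : nat) (T : X -> Y) : set R :=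
  [set approx n (T \o u) | u in [set u : {linear l2 R s -> X} |
    bounded_op u /\ opnorm u <= 1]].

Definition weyl X Y (n : nat) (T : X -> Y) : R := sup (weyl_set n T).

Definition chang_set X Y (n : nat) (T : X -> Y) : set R :=
  [set approx n (v \o T) | v in [set v : {linear Y -> l2 R s} |
    bounded_op v /\ opnorm v <= 1]].

Definition chang X Y (n : nat) (T : X -> Y) : R := sup (chang_set n T).

Definition hilbert_set X Y (n : nat) (T : X -> Y) : set R :=
  [set approx n (uv.2 \o T \o uv.1) |
    uv in [set uv : {linear l2 R s -> X} * {linear Y -> l2 R s} |
      [/\ bounded_op uv.1, bounded_op uv.2 & opnorm uv.1 * opnorm uv.2 <= 1]]].

Definition hilbert X Y (n : nat) (T : X -> Y) : R := sup (hilbert_set n T).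

(* The real-valued [sup] and [inf] above are genuine: the sets are nonempty and
   bounded as soon as T is a bounded operator and n >= 1. *)

Lemma opnorm_has_sup X Y (T : {linear X -> Y}) : bounded_op T ->
  has_sup [set rnorm (T x) | x in [set x | rnorm x <= 1]].
Proof.
move=> [M TM]; split; first by exists (rnorm (T 0)), 0 => //=; rewrite rnorm0.
exists (Num.max M 0) => _ [x /= x1 <-]; apply: le_trans (TM x) _.
apply: (@le_trans _ _ (Num.max M 0 * rnorm x)).
  by rewrite ler_wpM2r ?rnorm_ge0 // le_max lexx.
by rewrite ler_piMr // le_max lexx orbT.
Qed.

Lemma opnorm_ge0 X Y (T : {linear X -> Y}) : bounded_op T -> 0 <= opnorm T.
Proof.
move=> Tb; apply: sup_upper_bound; first exact: opnorm_has_sup.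
by exists 0; rewrite /= ?linear0 rnorm0.
Qed.

Lemma rnorm_le_opnorm X Y (T : {linear X -> Y}) (x : X) : bounded_op T ->
  rnorm (T x) <= opnorm T * rnorm x.
Proof.
move=> Tb; have [x0|x0] := eqVneq (rnorm x) 0.
  by rewrite (rnorm_eq0 x0) linear0 !rnorm0 mulr0.
have xp : 0 < rnorm x by rewrite lt_neqAle eq_sym x0 rnorm_ge0.
have sc0 : rnorm (scalar_of s (rnorm x)^-1) = (rnorm x)^-1.
  by rewrite /rnorm ger0_norm ?scalar_ofK // -scalar_of0 ler_scalar_of
    invr_ge0 rnorm_ge0.
rewrite -ler_pdivrMr // mulrC -sc0 -rnormZ -linearZ.
apply: sup_upper_bound; first exact: opnorm_has_sup.
by exists (scalar_of s (rnorm x)^-1 *: x) => //=; rewrite rnormZ sc0 mulVf.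
Qed.

Lemma opnorm_le X Y (T : X -> Y) (M : R) :
  (forall x, rnorm x <= 1 -> rnorm (T x) <= M) -> opnorm T <= M.
Proof.
move=> TM; apply: ge_sup => [|_ [x x1 <-]]; last exact: TM.
by exists (rnorm (T 0)), 0; rewrite /= ?rnorm0.
Qed.

Lemma bounded_comp X Y Z (T : {linear X -> Y}) (v : {linear Y -> Z}) :
  bounded_op T -> bounded_op v ->
  bounded_op (v \o T) /\ opnorm (v \o T) <= opnorm v * opnorm T.
Proof.
move=> Tb vb; have vT x : rnorm (v (T x)) <= opnorm v * opnorm T * rnorm x.
  apply: le_trans (rnorm_le_opnorm _ vb) _.
  by rewrite -mulrA ler_wpM2l ?opnorm_ge0 ?rnorm_le_opnorm.
split; first by exists (opnorm v * opnorm T).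
apply: opnorm_le => x x1; apply: le_trans (vT x) _.
by rewrite ler_piMr // mulr_ge0 ?opnorm_ge0.
Qed.

Lemma rank_lt0 X Y n : (0 < n)%N -> rank_lt (\0 : {linear X -> Y}) n.
Proof.
move=> n0; exists 0%N => //; exists (fun=> 0); split=> [c _ []//|].
apply/seteqP; split=> _ [x _ <-]; last by exists 0; rewrite //= big_ord0.
by exists (fun=> 0); rewrite //= big_ord0.
Qed.

Lemma bounded_op0 X Y : bounded_op (\0 : {linear X -> Y}).
Proof. by exists 0 => x; rewrite /= rnorm0 mul0r. Qed.

Lemma approx_set0 X Y n (T : X -> Y) : (0 < n)%N -> approx_set n T (opnorm T).
Proof.
move=> n0; exists \0; first by split; [exact: bounded_op0|exact: rank_lt0].
by congr opnorm; apply/funext => x /=; rewrite subr0.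
Qed.

Lemma approx_has_inf X Y n (T : {linear X -> Y}) : bounded_op T -> (0 < n)%N ->
  has_inf (approx_set n T).
Proof.
move=> [M TM] n0; split; first by exists (opnorm T); exact: approx_set0.
exists 0 => _ [S [[N SN] _] <-]; apply: opnorm_ge0; exists (M + N) => x /=.
by rewrite (le_trans (ler_rnormD _ _)) // rnormN mulrDl lerD.
Qed.

Lemma approx_bounds X Y n (T : {linear X -> Y}) : bounded_op T -> (0 < n)%N ->
  0 <= approx n T <= opnorm T.
Proof.
move=> Tb n0; have hi := approx_has_inf Tb n0; apply/andP; split.
  apply: lb_le_inf; first exact: hi.1.
  case: Tb => M TM _ [S [[N SN] _] <-]; apply: opnorm_ge0; exists (M + N) => x /=.
  by rewrite (le_trans (ler_rnormD _ _)) // rnormN mulrDl lerD.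
by apply: ge_inf; [exact: hi.2|exact: approx_set0].
Qed.

Lemma opnorm0_le X Y (M : R) : 0 <= M -> opnorm (\0 : {linear X -> Y}) <= M.
Proof. by move=> M0; apply: opnorm_le => x _; rewrite /= rnorm0. Qed.

Lemma weyl_has_sup X Y n (T : {linear X -> Y}) : bounded_op T -> (0 < n)%N ->
  has_sup (weyl_set n T).
Proof.
move=> Tb n0; split.
  exists (approx n (T \o (\0 : {linear l2 R s -> X}))), \0 => //.
  by split; [exact: bounded_op0|rewrite opnorm0_le].
exists (opnorm T) => _ [u [ub u1] <-]; have [Tub Tu] := bounded_comp ub Tb.
have /andP[_ h] := approx_bounds Tub n0.
by rewrite (le_trans h) // (le_trans Tu) // ler_piMr ?opnorm_ge0.
Qed.

Lemma chang_has_sup X Y n (T : {linear X -> Y}) : bounded_op T -> (0 < n)%N ->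
  has_sup (chang_set n T).
Proof.
move=> Tb n0; split.
  exists (approx n ((\0 : {linear Y -> l2 R s}) \o T)), \0 => //.
  by split; [exact: bounded_op0|rewrite opnorm0_le].
exists (opnorm T) => _ [v [vb v1] <-]; have [vTb vT] := bounded_comp Tb vb.
have /andP[_ h] := approx_bounds vTb n0.
by rewrite (le_trans h) // (le_trans vT) // ler_piMl ?opnorm_ge0.
Qed.

Lemma hilbert_has_sup X Y n (T : {linear X -> Y}) : bounded_op T -> (0 < n)%N ->
  has_sup (hilbert_set n T).
Proof.
move=> Tb n0; split.
  pose u : {linear l2 R s -> X} := \0; pose v : {linear Y -> l2 R s} := \0.
  exists (approx n (v \o T \o u)), (u, v) => //.
  split; [exact: bounded_op0|exact: bounded_op0|].
  by rewrite mulr_ile1 ?opnorm_ge0 ?opnorm0_le //; exact: bounded_op0.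
exists (opnorm T) => _ [[u v] /= [ub vb uv1] <-].
have [vTb vT] := bounded_comp Tb vb; have [vTub vTu] := bounded_comp ub vTb.
have /andP[_ h] := approx_bounds vTub n0.
rewrite (le_trans h) // (le_trans vTu) //.
apply: (@le_trans _ _ (opnorm v * opnorm T * opnorm u)).
  by rewrite ler_wpM2r ?opnorm_ge0.
by rewrite mulrAC ler_piMl ?opnorm_ge0 // mulrC.
Qed.

End Operators.

(* Main.v *)
(* A bounded operator T from c0 to l1 is a bounded bilinear form on finitely
   supported sequences, so Grothendieck's inequality bounds
   \sum_m phi_m (T x_m) by 32 ||T|| A B as soon as
   \sum_m |x_m(j)|^2 <= A^2 and \sum_m |phi_m(e_i)|^2 <= B^2.
   If T u is not within eps of the operators of rank d, a greedy choice gives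
   orthonormal x_1, ..., x_d in l2 with ||T u x_m|| > eps; taking for phi_m a
   functional norming T u x_m, the inequality yields d eps <= 32 ||T|| sqrt d.
   For v T the same is done with an orthonormal family in the range, and for
   v T u with both, where A and B stay bounded and eps <= 64 ||T|| / d.  The
   inequality applied to disjoint blocks also shows that the tails of T tend to
   0 in norm; subtracting a finite rank truncation of T thus replaces ||T|| by
   an arbitrarily small constant, whence the limits 0.
   Grothendieck's inequality itself is proved by truncating Rademacher sums. *)
From HB Require Import structures.
Require Import Defs.
From mathcomp Require Import all_boot all_order all_algebra.
From mathcomp Require Import ring lra zify complex.
From mathcomp Require Import boolp classical_sets functions reals topology.
From mathcomp Require Import normedtype sequences.
Set Implicit Arguments.
Unset Strict Implicit.
Unset Printing Implicit Defensive.
Import Order.TTheory GRing.Theory Num.Theory.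
Import numFieldNormedType.Exports.
Local Open Scope classical_set_scope.
Local Open Scope ring_scope.

(** * Grothendieck's inequality for real matrices *)

Section Rademacher.
Context {R : realType} {V : zmodType}.

(** Signed sums of the members of [s], listed up to a global sign: the head always enters with sign
    plus. The summands of interest are even, so a sum over this list is [2 ^ size s] times an
    expectation over independent random signs. *)
Fixpoint rademacher (s : seq V) : seq V :=
  if s is x :: s' then
    [seq x + z | z <- rademacher s'] ++ [seq x - z | z <- rademacher s']
  else [:: 0].

Lemma size_rademacher s : size (rademacher s) = (2 ^ size s)%N.
Proof.
by elim: s => //= x s IH; rewrite size_cat !size_map IH addnn -mul2n -expnS.
Qed.

Variable f g : V -> R.
Hypothesis fD : forall x y, f (x + y) = f x + f y.
Hypothesis gD : forall x y, g (x + y) = g x + g y.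

Let f0 : f 0 = 0. Proof. by apply: (addIr (f 0)); rewrite -fD !add0r. Qed.
Let fN x : f (- x) = - f x.
Proof. by apply/eqP; rewrite -addr_eq0 -fD addNr f0. Qed.
Let g0 : g 0 = 0. Proof. by apply: (addIr (g 0)); rewrite -gD !add0r. Qed.
Let gN x : g (- x) = - g x.
Proof. by apply/eqP; rewrite -addr_eq0 -gD addNr g0. Qed.

(** Cross terms cancel between [x + z] and [x - z], so signed sums keep scalar products up to the
    number of sign patterns. *)
Lemma rademacher_ip s : \sum_(z <- rademacher s) f z * g z =
  2 ^+ size s * \sum_(x <- s) f x * g x.
Proof.
elim: s => [|x s IH] /=; first by rewrite big_seq1 big_nil f0 mul0r mulr0.
rewrite big_cat !big_map big_cons /= -big_split /= (eq_bigr (fun z =>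
  f x * g x *+ 2 + 2 * (f z * g z))); last first.
  by move=> z _; rewrite !fD !gD fN gN; ring.
rewrite big_split /= -mulr_sumr IH big_const_seq count_predT iter_addr_0.
by rewrite size_rademacher -[_ *+ (2 ^ _)]mulr_natr natrX exprS; ring.
Qed.

End Rademacher.

Section RademacherMoment.
Context {R : realType} {V : zmodType}.
Variable f : V -> R.
Hypothesis fD : forall x y, f (x + y) = f x + f y.

Let f0 : f 0 = 0. Proof. by apply: (addIr (f 0)); rewrite -fD !add0r. Qed.
Let fN x : f (- x) = - f x.
Proof. by apply/eqP; rewrite -addr_eq0 -fD addNr f0. Qed.

Lemma rademacher_moment2 s : \sum_(z <- rademacher s) f z ^+ 2 =
  2 ^+ size s * \sum_(x <- s) f x ^+ 2.
Proof.
under eq_bigr do rewrite expr2; rewrite (rademacher_ip fD fD).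
by under eq_bigr do rewrite -expr2.
Qed.

(** Odd powers cancel in [(a + b)^4 + (a - b)^4 = 2 a^4 + 12 a^2 b^2 + 2 b^4]. With the constant 3
    the mixed terms on both sides of the induction agree exactly, and a multiple of [f x ^+ 4] is
    left over. *)
Lemma rademacher_moment4 s : \sum_(z <- rademacher s) f z ^+ 4 <=
  2 ^+ size s * (3 * (\sum_(x <- s) f x ^+ 2) ^+ 2).
Proof.
elim: s => [|x s IH] /=; first by rewrite big_seq1 big_nil f0 !expr0n /= !mulr0.
rewrite big_cat !big_map big_cons /= -big_split /= (eq_bigr (fun z =>
  f x ^+ 4 *+ 2 + 2 * f z ^+ 4 + 12 * f x ^+ 2 * f z ^+ 2)); last first.
  by move=> z _; rewrite !fD fN; ring.
rewrite !big_split /= -!mulr_sumr rademacher_moment2 big_const_seq count_predT iter_addr_0.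
rewrite size_rademacher -[_ *+ (2 ^ _)]mulr_natr natrX [2 ^+ _.+1]exprS.
set S := \sum_(x <- s) _ in IH *; set p : R := 2 ^+ size s in IH *.
have p0 : 0 <= p by rewrite exprn_ge0.
have := IH; set W := \sum_(z <- _) _ => WS.
have pf : 0 <= p * f x ^+ 4 by rewrite mulr_ge0 // (exprM _ 2 2) sqr_ge0.
rewrite -subr_ge0 (_ : _ - _ = 2 * (p * (3 * S ^+ 2) - W) + 4 * (p * f x ^+ 4)).
  by rewrite addr_ge0 // mulr_ge0 // subr_ge0.
by ring.
Qed.

End RademacherMoment.

(** * Truncation of real numbers and its error *)

Section Clamp.
Context {R : realType}.

Definition clamp (c a : R) : R := Num.max (- c) (Num.min c a).

Variant clamp_spec (c a : R) : R -> Prop :=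
| ClampHigh of c <= a : clamp_spec c a c
| ClampId of - c <= a <= c : clamp_spec c a a
| ClampLow of a <= - c : clamp_spec c a (- c).

Lemma clampP (c a : R) : 0 <= c -> clamp_spec c a (clamp c a).
Proof.
rewrite /clamp => c0; have [ca|/ltW ac] := leP c a.
  by rewrite max_r; [constructor|lra].
have [ca|/ltW ca] := leP (- c) a; constructor => //.
by rewrite ca.
Qed.

Lemma normr_clamp_le (c a : R) : 0 <= c -> `|clamp c a| <= c.
Proof. by move=> c0; rewrite ler_norml; case: (clampP a c0) => h; lra. Qed.

Lemma sqr_clamp_le (c a : R) : 0 <= c -> clamp c a ^+ 2 <= a ^+ 2.
Proof. by move=> c0; case: (clampP a c0) => h; nra. Qed.

(** Beyond the threshold the error is [|a| - c], and [4 c (|a| - c) <= a^2] because [(|a| - 2c)^2]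
    is nonnegative; squaring trades the error for a fourth power. *)
Lemma sqr_sub_clamp_le (c a : R) : 0 < c ->
  (a - clamp c a) ^+ 2 <= a ^+ 4 / (16 * c ^+ 2).
Proof.
move=> c0; rewrite ler_pdivlMr ?mulr_gt0 ?exprn_gt0 //.
have h : 4 * c * `|a - clamp c a| <= a ^+ 2.
  case: (clampP a (ltW c0)) => h; last 1 first.
  - by rewrite ler0_norm; [have := sqr_ge0 (a + 2 * c); nra|lra].
  - by rewrite ger0_norm; [have := sqr_ge0 (a - 2 * c); nra|lra].
  - by rewrite subrr normr0 mulr0 sqr_ge0.
have : (4 * c * `|a - clamp c a|) ^+ 2 <= (a ^+ 2) ^+ 2.
  by rewrite ler_sqr // nnegrE ?sqr_ge0 // !mulr_ge0 // ltW.
rewrite [X in _ -> _ * _ <= X](exprM a 2 2); apply: le_trans.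
rewrite !exprMn real_normK ?num_real // le_eqVlt; apply/orP; left; apply/eqP.
by ring.
Qed.

End Clamp.

(** * Bilinear forms and the bootstrap of the Hilbert space constant *)

Section Grothendieck.
Context {R : realType} {I J : finType} (t : I -> J -> R).
Implicit Types (x : I -> R) (y : J -> R).

Definition bilin x y : R := \sum_i \sum_j t i j * (x i * y j).

Lemma bilinDl x x' y : bilin (x + x') y = bilin x y + bilin x' y.
Proof.
rewrite -big_split; apply: eq_bigr => i _; rewrite -big_split.
by apply: eq_bigr => j _; rewrite /= mulrDl mulrDr.
Qed.

Lemma bilinDr x y y' : bilin x (y + y') = bilin x y + bilin x y'.
Proof.
rewrite -big_split; apply: eq_bigr => i _; rewrite -big_split.
by apply: eq_bigr => j _; rewrite /= !mulrDr.
Qed.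

Lemma bilinZ (a b : R) x y :
  bilin (fun i => a * x i) (fun j => b * y j) = a * b * bilin x y.
Proof.
rewrite mulr_sumr; apply: eq_bigr => i _; rewrite mulr_sumr.
by apply: eq_bigr => j _; rewrite /=; ring.
Qed.

Lemma bilin_sum (T : Type) (s : seq T) (f : T -> I -> R) (g : T -> J -> R) :
  \sum_(z <- s) bilin (f z) (g z) =
  \sum_i \sum_j t i j * \sum_(z <- s) f z i * g z j.
Proof.
rewrite exchange_big; apply: eq_bigr => i _; rewrite exchange_big.
by apply: eq_bigr => j _; rewrite mulr_sumr.
Qed.

Variable M : R.
Hypothesis tM : forall x y, (forall i, `|x i| <= 1) -> (forall j, `|y j| <= 1) ->
  bilin x y <= M.

Lemma bilin_le (c : R) x y : 0 < c ->
  (forall i, `|x i| <= c) -> (forall j, `|y j| <= c) -> bilin x y <= M * c ^+ 2.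
Proof.
move=> c0 xc yc; rewrite -ler_pdivrMr ?exprn_gt0 // mulrC expr2 invfM -bilinZ.
have cn (a : R) : `|a| <= c -> `|c^-1 * a| <= 1.
  by rewrite normrM normfV (gtr0_norm c0) ler_pdivrMl // mulr1.
by apply: tM => k; exact: cn.
Qed.

(** By [bilin_sum], the left-hand side is the form with products replaced by scalar products of the
    vectors [(f z i)_z] and [(g z j)_z]. The index list is arbitrary because the improvement step
    replaces [s] by the much longer list of its signed sums. *)
Definition hilbert_bound (K : R) := forall (T : Type) (s : seq T)
  (f : T -> I -> R) (g : T -> J -> R) (A : R), 0 < A ->
  (forall i, \sum_(z <- s) f z i ^+ 2 <= A) ->
  (forall j, \sum_(z <- s) g z j ^+ 2 <= A) ->
  \sum_(z <- s) bilin (f z) (g z) <= K * A.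

(** Each scalar product is at most [A] in absolute value. The size of this constant is irrelevant:
    it only gives the iteration a finite start. *)
Lemma hilbert_bound_crude : hilbert_bound (\sum_i \sum_j `|t i j|).
Proof.
move=> T s f g A A0 fA gA; rewrite bilin_sum mulr_suml ler_sum // => i _.
rewrite mulr_suml ler_sum // => j _; apply: le_trans (ler_norm _) _.
rewrite normrM ler_wpM2l // (le_trans (ler_norm_sum _ _ _)) //.
apply: (@le_trans _ _ (\sum_(z <- s) (f z i ^+ 2 + g z j ^+ 2) / 2)).
  apply: ler_sum => z _; rewrite normrM.
  rewrite -(real_normK (num_real (f z i))) -(real_normK (num_real (g z j))).
  have := sqr_ge0 (`|f z i| - `|g z j|); nra.
by rewrite -mulr_suml big_split /=; have := fA i; have := gA j; lra.
Qed.

(* Replace a vector by the corresponding Rademacher sum, which has the same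
   scalar products, and truncate it at twice its L2 norm: the truncated part is
   controlled by M, and by the fourth moment the rest has L2 norm at most a
   quarter of the norm of the vector. *)
Lemma hilbert_bound_improve K : hilbert_bound K -> hilbert_bound (4 * M + K / 2).
Proof.
move=> hK T s f g A A0 fA gA.
pose V := ((I -> R) * (J -> R))%type.
pose w := rademacher [seq (f z, g z) : V | z <- s].
pose p : R := 2 ^+ size s.
have p0 : 0 < p by rewrite exprn_gt0.
have fD i (u v : V) : (u + v).1 i = u.1 i + v.1 i by [].
have gD j (u v : V) : (u + v).2 j = u.2 j + v.2 j by [].
have -> : \sum_(z <- s) bilin (f z) (g z) = p^-1 * \sum_(z <- w) bilin z.1 z.2.
  rewrite !bilin_sum mulr_sumr; apply: eq_bigr => i _.
  rewrite mulr_sumr; apply: eq_bigr => j _.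
  rewrite mulrCA (rademacher_ip (fD i) (gD j)) big_map size_map mulKf //.
  by rewrite gt_eqF.
rewrite ler_pdivrMl //.
(* The truncated part then contributes [M * c ^+ 2 = 4 * M * A], and four times the error still has
   mean square at most [3 * A / 4], hence is again admissible for [K]. *)
pose c := 2 * Num.sqrt A.
have c0 : 0 < c by rewrite mulr_gt0 // sqrtr_gt0.
have c2 : c ^+ 2 = 4 * A by rewrite exprMn sqr_sqrtr ?ltW //; ring.
pose k1 (z : V) i := clamp c (z.1 i); pose l1 (z : V) i := z.1 i - k1 z i.
pose k2 (z : V) j := clamp c (z.2 j); pose l2 (z : V) j := z.2 j - k2 z j.
have mom2 (h : V -> R) : (forall u v, h (u + v) = h u + h v) ->
    \sum_(z <- s) h (f z, g z) ^+ 2 <= A -> \sum_(z <- w) h z ^+ 2 <= p * A.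
  by move=> hD hA; rewrite (rademacher_moment2 hD) big_map size_map ler_pM2l.
have tail (h : V -> R) : (forall u v, h (u + v) = h u + h v) ->
    \sum_(z <- s) h (f z, g z) ^+ 2 <= A ->
    \sum_(z <- w) (4 * (h z - clamp c (h z))) ^+ 2 <= p * A.
  move=> hD hA.
  apply: (@le_trans _ _ (\sum_(z <- w) h z ^+ 4 / (4 * A))).
    apply: ler_sum => z _; rewrite exprMn.
    have := sqr_sub_clamp_le (h z) c0; rewrite c2.
    rewrite !ler_pdivlMr ?mulr_gt0 //; nra.
  rewrite -mulr_suml ler_pdivrMr ?mulr_gt0 //.
  apply: le_trans (rademacher_moment4 hD _) _; rewrite size_map big_map -/p.
  rewrite -mulrA ler_pM2l //.
  set S := \sum_(z <- s) _ in hA *.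
  have S0 : 0 <= S by apply: sumr_ge0 => z _; exact: sqr_ge0.
  by nra.
(* Truncate the first argument, then the second. Each error is scaled up by 4, so the two error
   terms cost [K / 4] each. *)
have sumE : \sum_(z <- w) bilin z.1 z.2 = \sum_(z <- w) bilin (k1 z) (k2 z) +
    4^-1 * \sum_(z <- w) bilin (fun i => 4 * l1 z i) (fun j => 1 * k2 z j) +
    4^-1 * \sum_(z <- w) bilin (fun i => 1 * z.1 i) (fun j => 4 * l2 z j).
  rewrite !mulr_sumr -!big_split; apply: eq_bigr => z _ /=.
  rewrite !bilinZ mulr1 mul1r !mulKf ?pnatr_eq0 //.
  have e1 : z.1 = k1 z + l1 z by apply/funext => i; rewrite /l1 /= addrC subrK.
  have e2 : z.2 = k2 z + l2 z by apply/funext => i; rewrite /l2 /= addrC subrK.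
  by rewrite -bilinDl -e1 -bilinDr -e2.
have b1 : \sum_(z <- w) bilin (k1 z) (k2 z) <= p * (4 * M * A).
  apply: (@le_trans _ _ (\sum_(z <- w) M * c ^+ 2)).
    by apply: ler_sum => z _; apply: bilin_le => [//|k|k]; exact/normr_clamp_le/ltW.
  rewrite big_const_seq count_predT iter_addr_0 size_rademacher size_map.
  rewrite -[_ *+ (2 ^ _)]mulr_natl natrX -/p c2 le_eqVlt.
  by apply/orP; left; apply/eqP; ring.
have pA : 0 < p * A by rewrite mulr_gt0.
(* The sums over [w] are not normalised, so [hK] is applied with [p * A] as the bound on squared
   norms. *)
have b2 : \sum_(z <- w) bilin (fun i => 4 * l1 z i) (fun j => 1 * k2 z j) <=
    K * (p * A).
  apply: hK => // [i|j]; first exact: (tail (fun z => z.1 i) (fD i) (fA i)).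
  apply: le_trans _ (mom2 (fun z => z.2 j) (gD j) (gA j)).
  apply: ler_sum => z _.
  by rewrite mul1r sqr_clamp_le // ltW.
have b3 : \sum_(z <- w) bilin (fun i => 1 * z.1 i) (fun j => 4 * l2 z j) <=
    K * (p * A).
  apply: hK => // [i|j]; last exact: (tail (fun z => z.2 j) (gD j) (gA j)).
  apply: le_trans _ (mom2 (fun z => z.1 i) (fD i) (fA i)).
  apply: ler_sum => z _.
  by rewrite mul1r.
by rewrite sumE; nra.
Qed.

(** [8 * M] is the fixed point of [K |-> 4 * M + K / 2], and every round halves the distance to it.
    The start [8 * M + C] is admissible since [C] is and [M] is nonnegative, as the form at 0
    shows. *)
Lemma hilbert_bound_grothendieck : hilbert_bound (8 * M).
Proof.
pose C := \sum_i \sum_j `|t i j|.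
have iter n : hilbert_bound (8 * M + C / 2 ^+ n).
  elim: n => [|n /hilbert_bound_improve].
    have M0 : 0 <= M.
      have := @tM 0 0; rewrite /bilin /=; under eq_bigr do under eq_bigr do
        rewrite !mul0r mulr0; rewrite big1 => [h|i _]; last by rewrite big1.
      by apply: h => k; rewrite normr0.
    move=> T s f g A A0 fA gA; apply: le_trans (hilbert_bound_crude A0 fA gA) _.
    by rewrite ler_pM2r // expr0 divr1 lerDr mulr_ge0.
  rewrite (_ : 4 * M + _ = 8 * M + C / 2 ^+ n.+1) // exprS; field.
  by rewrite expf_neq0 ?pnatr_eq0.
move=> T s f g A A0 fA gA.
apply: (@cvgr_to_ge _ \oo _ _ (fun n => 8 * M * A + C * A * 2^-1 ^+ n)).
  rewrite -[X in _ --> X](addr0 (8 * M * A)); apply: cvgD; first exact: cvg_cst.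
  apply: (@cvg_geometric _ (C * A)).
  by rewrite ger0_norm ?invr_ge0 // invf_lt1 // ltr1n.
apply: nearW => n; rewrite [C * A * _]mulrAC -mulrDl exprVn; exact: iter.
Qed.

Theorem grothendieck_inequality (T : Type) (s : seq T) (f : T -> I -> R)
    (g : T -> J -> R) (A B : R) : 0 < A -> 0 < B ->
  (forall i, \sum_(z <- s) f z i ^+ 2 <= A ^+ 2) ->
  (forall j, \sum_(z <- s) g z j ^+ 2 <= B ^+ 2) ->
  \sum_(z <- s) bilin (f z) (g z) <= 8 * M * (A * B).
Proof.
move=> A0 B0 fA gB; rewrite -ler_pdivrMr ?mulr_gt0 // mulrC mulr_sumr.
under eq_bigr do rewrite invfM -bilinZ.
rewrite -[leRHS]mulr1; apply: hilbert_bound_grothendieck => // k;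
  under eq_bigr do rewrite exprMn.
  by rewrite -mulr_sumr exprVn ler_pdivrMl ?exprn_gt0 // mulr1.
by rewrite -mulr_sumr exprVn ler_pdivrMl ?exprn_gt0 // mulr1.
Qed.

End Grothendieck.

(** * Real and complex scalars *)

Section Scalars.
Context {R : realType} {s : scalar_kind}.
Local Notation K := (scalars R s).
Implicit Types (z w : K) (a b : R).

Definition scalar_im : K -> R :=
  match s with
  | RealScalars => fun=> 0
  | ComplexScalars => fun z : (R[i])%C => complex.Im z
  end.

(* The imaginary unit; it is 0 in the real case, where imaginary parts vanish. *)
Definition scalar_i : K :=
  match s with RealScalars => 0 | ComplexScalars => ('i)%C end.

Definition scalar_conj : K -> K :=
  match s with RealScalars => id | ComplexScalars => @conjc R end.

(** In the real case [scalar_i] is 0 and [b] is lost, which lets one computation with pairs of real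
    coordinates serve both scalar fields. *)
Definition scalar_mk a b : K := scalar_of s a + scalar_i * scalar_of s b.

Lemma scalar_mkK z : scalar_mk (scalar_re z) (scalar_im z) = z.
Proof.
rewrite /scalar_mk /scalar_i /scalar_im; case: s z => /= [z|[x y]].
  by rewrite mulr0 addr0.
by apply/eqP; rewrite eq_complex /=; apply/andP; split; apply/eqP; ring.
Qed.


Lemma scalar_reD z w : scalar_re (z + w) = scalar_re z + scalar_re w.
Proof. by case: s z w => //= -[a b] [c d]. Qed.

Lemma scalar_imD z w : scalar_im (z + w) = scalar_im z + scalar_im w.
Proof. by rewrite /scalar_im; case: s z w => /= [*|[a b] [c d] //]; rewrite addr0. Qed.

Lemma scalar_re0 : scalar_re (0 : K) = 0. Proof. by case: s. Qed.

Lemma scalar_im0 : scalar_im (0 : K) = 0. Proof. by rewrite /scalar_im; case: s. Qed.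

Lemma scalar_reM z w :
  scalar_re (z * w) = scalar_re z * scalar_re w - scalar_im z * scalar_im w.
Proof.
by rewrite /scalar_im; case: s z w => /= [*|[a b] [c d] //]; rewrite mulr0 subr0.
Qed.

Lemma scalar_imM z w :
  scalar_im (z * w) = scalar_re z * scalar_im w + scalar_im z * scalar_re w.
Proof.
by rewrite /scalar_im; case: s z w => /= [*|[a b] [c d] //]; rewrite mulr0 mul0r addr0.
Qed.

Lemma scalar_re_of a : scalar_re (scalar_of s a) = a.
Proof. exact: scalar_ofK. Qed.

Lemma scalar_im_of a : scalar_im (scalar_of s a) = 0.
Proof. by rewrite /scalar_im; case: s. Qed.

Lemma scalar_re_conj z : scalar_re (scalar_conj z) = scalar_re z.
Proof. by rewrite /scalar_conj; case: s z => //= -[a b]. Qed.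

Lemma scalar_im_conj z : scalar_im (scalar_conj z) = - scalar_im z.
Proof. by rewrite /scalar_conj /scalar_im; case: s z => //= [?|[a b] //]; rewrite oppr0. Qed.

Lemma scalar_conj_mk a b : scalar_conj (scalar_mk a b) = scalar_mk a (- b).
Proof.
rewrite /scalar_mk /scalar_conj /scalar_i; case: s => /=; first by rewrite !mul0r.
by apply/eqP; rewrite eq_complex /=; apply/andP; split; apply/eqP; ring.
Qed.

Lemma mulr_scalar_mk z a b : z * scalar_mk a b =
  scalar_mk (scalar_re z * a - scalar_im z * b) (scalar_re z * b + scalar_im z * a).
Proof.
rewrite /scalar_mk /scalar_im /scalar_i; case: s z => /= [z|[x y]].
  by rewrite !mul0r subr0 !addr0.
by apply/eqP; rewrite eq_complex /=; apply/andP; split; apply/eqP; ring.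
Qed.

Lemma scalar_mkD a b a' b' :
  scalar_mk (a + a') (b + b') = scalar_mk a b + scalar_mk a' b'.
Proof. by rewrite /scalar_mk !scalar_ofD mulrDr addrACA. Qed.

Lemma scalar_mk0 a : scalar_mk a 0 = scalar_of s a.
Proof. by rewrite /scalar_mk scalar_of0 mulr0 addr0. Qed.

Lemma scalar_ext z w :
  scalar_re z = scalar_re w -> scalar_im z = scalar_im w -> z = w.
Proof. by rewrite -{3}(scalar_mkK z) => -> ->; rewrite scalar_mkK. Qed.

Lemma rnorm_sqr z : rnorm z ^+ 2 = scalar_re z ^+ 2 + scalar_im z ^+ 2.
Proof.
rewrite /rnorm /scalar_im; case: s z => /= [z|[a b]].
  by rewrite expr0n addr0 real_normK ?num_real.
by rewrite sqr_sqrtr // addr_ge0 ?sqr_ge0.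
Qed.

Lemma normr_re_le z : `|scalar_re z| <= rnorm z.
Proof.
rewrite -ler_sqr ?nnegrE ?rnorm_ge0 // rnorm_sqr real_normK ?num_real //.
by rewrite lerDl sqr_ge0.
Qed.

Lemma normr_im_le z : `|scalar_im z| <= rnorm z.
Proof.
rewrite -ler_sqr ?nnegrE ?rnorm_ge0 // rnorm_sqr real_normK ?num_real //.
by rewrite lerDr sqr_ge0.
Qed.

Lemma re_le_rnorm z : scalar_re z <= rnorm z.
Proof. exact: le_trans (ler_norm _) (normr_re_le z). Qed.

Lemma rnorm_conj z : rnorm (scalar_conj z) = rnorm z.
Proof.
apply/eqP; rewrite -(eqrXn2 (_ : 0 < 2)%N) ?rnorm_ge0 //.
by rewrite !rnorm_sqr scalar_re_conj scalar_im_conj sqrrN.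
Qed.

Lemma mulr_conj z : z * scalar_conj z = scalar_of s (rnorm z ^+ 2).
Proof.
by apply: scalar_ext; rewrite ?scalar_reM ?scalar_imM ?scalar_re_of ?scalar_im_of
  ?rnorm_sqr scalar_re_conj scalar_im_conj; ring.
Qed.

Lemma scalar_conjM z w : scalar_conj (z * w) = scalar_conj z * scalar_conj w.
Proof. by rewrite /scalar_conj; case: s z w => //= z w; rewrite rmorphM. Qed.

Lemma scalar_conjK : involutive scalar_conj.
Proof. by rewrite /scalar_conj; case: s => //; exact: conjcK. Qed.

Lemma scalar_conj0 : scalar_conj 0 = 0.
Proof. by apply: scalar_ext; rewrite ?scalar_re_conj ?scalar_im_conj ?scalar_im0 ?oppr0. Qed.

Lemma scalar_of1 : scalar_of s (1 : R) = 1. Proof. by case: s. Qed.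

Lemma rnorm_of a : rnorm (scalar_of s a) = `|a|.
Proof.
rewrite -[LHS]ger0_norm ?rnorm_ge0 // -sqrtr_sqr rnorm_sqr scalar_re_of.
by rewrite scalar_im_of expr0n addr0 sqrtr_sqr.
Qed.

Lemma rnorm1 : rnorm (1 : K) = 1. Proof. by rewrite -scalar_of1 rnorm_of normr1. Qed.

Lemma rnorm_i : rnorm scalar_i <= 1.
Proof.
rewrite -(@expr_le1 _ 2) ?rnorm_ge0 // rnorm_sqr /scalar_im /scalar_i.
by case: s => /=; rewrite !expr0n ?expr1n /= ?addr0 ?add0r ?ler01.
Qed.

Lemma scalar_re_sum (I : Type) (r : seq I) (P : pred I) (F : I -> K) :
  scalar_re (\sum_(i <- r | P i) F i) = \sum_(i <- r | P i) scalar_re (F i).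
Proof. exact: (big_morph _ scalar_reD scalar_re0). Qed.

Lemma ler_rnorm_sum (V : normedZmodType K) (I : Type) (r : seq I) (P : pred I)
    (F : I -> V) :
  rnorm (\sum_(i <- r | P i) F i) <= \sum_(i <- r | P i) rnorm (F i).
Proof.
elim/big_ind2: _ => [|x1 x2 y1 y2 h1 h2|//]; first by rewrite rnorm0.
by apply: le_trans (ler_rnormD _ _) _; rewrite lerD.
Qed.

(** Take the conjugate of [z] divided by its modulus, and 0 when [z] vanishes. *)
Lemma scalar_phase z : exists2 c : K, rnorm c <= 1 & scalar_re (c * z) = rnorm z.
Proof.
have [z0|z0] := eqVneq (rnorm z) 0.
  by exists 0; [rewrite rnorm0|rewrite mul0r scalar_re0 z0].
exists (scalar_of s (rnorm z)^-1 * scalar_conj z).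
  by rewrite rnormM rnorm_of rnorm_conj normfV ger0_norm ?rnorm_ge0 // mulVf.
rewrite -mulrA [scalar_conj z * z]mulrC mulr_conj -scalar_ofM scalar_re_of.
by rewrite expr2 mulKf.
Qed.

End Scalars.

(** * Rank and approximation numbers *)

Section Rank.
Context {R : realType} {s : scalar_kind}.
Local Notation K := (scalars R s).
Implicit Types X Y Z : normedModType K.

Definition comb Y d (f : 'I_d -> Y) (c : 'I_d -> K) : Y := \sum_(i < d) c i *: f i.

Lemma comb0 Y d (f : 'I_d -> Y) : comb f (fun=> 0) = 0.
Proof. by rewrite /comb big1 // => i _; rewrite scale0r. Qed.

Lemma combZD Y d (f : 'I_d -> Y) a (c c' : 'I_d -> K) :
  comb f (fun i => a * c i + c' i) = a *: comb f c + comb f c'.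
Proof.
rewrite /comb scaler_sumr -big_split; apply: eq_bigr => i _.
by rewrite scalerDl scalerA.
Qed.

Definition ocons d (T : Type) (a : T) (c : 'I_d -> T) : 'I_d.+1 -> T :=
  fun i => oapp c a (unlift ord0 i).

Lemma ocons0 d (T : Type) (a : T) (c : 'I_d -> T) : ocons a c ord0 = a.
Proof. by rewrite /ocons unlift_none. Qed.

Lemma oconsS d (T : Type) (a : T) (c : 'I_d -> T) i :
  ocons a c (lift ord0 i) = c i.
Proof. by rewrite /ocons liftK. Qed.

Lemma comb_recl Y d (f : 'I_d.+1 -> Y) c :
  comb f c = c ord0 *: f ord0 +
             comb (fun i => f (lift ord0 i)) (fun i => c (lift ord0 i)).
Proof. by rewrite /comb big_ord_recl. Qed.

Lemma comb_ocons Y d (w : Y) (e : 'I_d -> Y) c :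
  comb (ocons w e) c = c ord0 *: w + comb e (fun i => c (lift ord0 i)).
Proof.
rewrite comb_recl ocons0; congr (_ + _); apply: eq_bigr => i _.
by rewrite oconsS.
Qed.

(** Gaussian elimination: drop [f ord0] and intersect [W] with the span of the rest; if some [w] of
    [W] lies outside that span, it is the one extra basis vector. This supplies the basis that
    [has_rank] demands, where only spanning families are at hand. *)
Lemma subspace_basis Y d (f : 'I_d -> Y) (W : set Y) : W 0 ->
  (forall a u v, W u -> W v -> W (a *: u + v)) -> W `<=` range (comb f) ->
  exists2 m, (m <= d)%N & exists e : 'I_m -> Y, lin_indep e /\ W = range (comb e).
Proof.
elim: d f W => [|d IH] f W W0 WD Wf.
  exists 0%N => //; exists f; split=> [c _ []//|]; apply/seteqP; split=> // _ [c _ <-].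
  by rewrite /comb big_ord0.
pose g i := f (lift ord0 i).
have [|||m md [e [eI We]]] := IH g (W `&` range (comb g)).
- by split=> //; exists (fun=> 0); rewrite ?comb0.
- move=> a u v [Wu [c _ cu]] [Wv [c' _ cv]]; split; first exact: WD.
  by exists (fun i => a * c i + c' i) => //; rewrite combZD cu cv.
- by move=> ? [].
have [Wg|/existsNP[w /not_implyP[Ww wg]]] :=
    pselect (forall w, W w -> range (comb g) w).
  exists m; first exact: leqW.
  exists e; split=> //; rewrite -We; apply/seteqP; split=> [w Ww|w []//].
  by split=> //; exact: Wg.
exists m.+1 => //; exists (ocons w e).
have WgE c : (W `&` range (comb g)) (comb e c) by rewrite We; exists c.
have We' c : W (comb e c) by case: (WgE c).
have ge c : range (comb g) (comb e c) by case: (WgE c).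
split.
  move=> c; rewrite -/(comb _ c) comb_ocons => c0.
  (* Otherwise [w] could be expressed through [e], hence through [g]. *)
  have c00 : c ord0 = 0.
    apply/eqP/negPn/negP => cn0; apply: wg; have [b _ bE] := ge (fun i => c (lift ord0 i)).
    exists (fun i => - (c ord0)^-1 * b i + 0) => //.
    rewrite (combZD g (- (c ord0)^-1) b (fun=> 0)) comb0 addr0 bE.
    rewrite -[comb e _](addKr (c ord0 *: w)) c0 addr0 scalerN scaleNr opprK.
    by rewrite scalerA mulVf // scale1r.
  move: c0; rewrite c00 scale0r add0r => /eI c0 i.
  by case: (unliftP ord0 i) => [j|] ->; [exact: c0|].
apply/seteqP; split=> [z Wz|_ [c _ <-]]; last first.
  by rewrite comb_ocons; apply: WD.
have [cw _ wE] := Wf _ Ww; have [cz _ zE] := Wf _ Wz.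
have cw0 : cw ord0 != 0.
  apply/eqP => cw0; apply: wg; exists (fun i => cw (lift ord0 i)) => //.
  by rewrite -wE comb_recl cw0 scale0r add0r.
(* This multiple of [w] cancels the [f ord0] coefficient of [z], so the difference falls into the
   span of [g]. *)
pose a := cz ord0 / cw ord0.
have : (W `&` range (comb g)) (- a *: w + z).
  split; first exact: WD.
  exists (fun i => - a * cw (lift ord0 i) + cz (lift ord0 i)) => //.
  rewrite (combZD g (- a) (fun i => cw (lift ord0 i)) (fun i => cz (lift ord0 i))).
  rewrite -wE -zE !comb_recl scalerDr scalerA mulNr divfK //.
  by rewrite [- cz ord0 *: _]scaleNr addrACA addNr add0r.
rewrite We => -[c _ cE]; exists (ocons a c) => //.
rewrite comb_ocons ocons0; under [X in comb e X]eq_fun do rewrite oconsS.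
by rewrite cE scaleNr addNKr.
Qed.

(** An upper bound on the rank that passes to sums and compositions without any choice of basis. *)
Definition spanned X Y (T : X -> Y) (d : nat) : Prop :=
  exists f : 'I_d -> Y, range T `<=` range (comb f).

Lemma spanned_rank_lt X Y (T : {linear X -> Y}) d n :
  spanned T d -> (d < n)%N -> rank_lt T n.
Proof.
move=> [f Tf] dn.
have [||m md [e [eI eT]]] := subspace_basis _ _ Tf.
- by exists 0; rewrite ?linear0.
- by move=> a _ _ [x _ <-] [y _ <-]; exists (a *: x + y); rewrite ?linearP.
by exists m; [exact: leq_ltn_trans dn|exists e].
Qed.

Lemma spannedD X Y (S T : X -> Y) m n :
  spanned S m -> spanned T n -> spanned (fun x => S x + T x) (m + n).
Proof.
move=> [f Sf] [g Tg].
exists (fun i : 'I_(m + n) =>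
  match fintype.split i with inl j => f j | inr j => g j end) => _ [x _ <-].
have [c _ <-] := Sf _ (imageT S x); have [c' _ <-] := Tg _ (imageT T x).
exists (fun i : 'I_(m + n) =>
  match fintype.split i with inl j => c j | inr j => c' j end) => //.
rewrite /comb big_split_ord /=; congr (_ + _); apply: eq_bigr => i _.
  by rewrite (unsplitK (inl i)).
by rewrite (unsplitK (inr i)).
Qed.

Lemma spanned_comp X Y Z (T : X -> Y) (v : {linear Y -> Z}) d :
  spanned T d -> spanned (v \o T) d.
Proof.
move=> [f Tf]; exists (v \o f) => _ [x _ <-]; have [c _ /= <-] := Tf _ (imageT T x).
by exists c => //; rewrite /comb linear_sum; apply: eq_bigr => i _; rewrite linearZ.
Qed.

Lemma spanned_precomp X Y Z (T : Y -> Z) (u : X -> Y) d :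
  spanned T d -> spanned (T \o u) d.
Proof. by move=> [f Tf]; exists f => _ [x _ <-]; apply: Tf; exists (u x). Qed.

Lemma approx_le X Y (T S : {linear X -> Y}) n d (M : R) : bounded_op T ->
  bounded_op S -> spanned S d -> (d < n)%N ->
  (forall x, rnorm x <= 1 -> rnorm (T x - S x) <= M) -> approx n T <= M.
Proof.
move=> Tb Sb Sd dn TM; have n0 : (0 < n)%N by exact: leq_ltn_trans dn.
apply: (@le_trans _ _ (opnorm (T \- S))); last exact: opnorm_le.
apply: ge_inf; first by case: (approx_has_inf Tb n0).
by exists S => //; split=> //; exact: spanned_rank_lt dn.
Qed.

Lemma bounded_opD X Y (S T : X -> Y) : bounded_op S -> bounded_op T ->
  bounded_op (fun x => S x + T x).
Proof.
move=> [M SM] [N TN]; exists (M + N) => x.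
by rewrite (le_trans (ler_rnormD _ _)) // mulrDl lerD.
Qed.

Lemma bounded_opB X Y (S T : X -> Y) : bounded_op S -> bounded_op T ->
  bounded_op (fun x => S x - T x).
Proof.
move=> Sb [N TN]; apply: bounded_opD => //; exists N => x; by rewrite rnormN.
Qed.

End Rank.

(** * The inner product of l2 *)

Section InnerProduct.
Context {R : realType} {s : scalar_kind}.
Local Notation K := (scalars R s).
Local Notation H := (l2 R s).
Implicit Types (x y z : H).

(** Real and imaginary parts are summed separately, so that limits are taken in [R] only. Linear in
    the first argument, conjugate linear in the second. *)
Definition ip x y : K :=
  scalar_mk (limn (series (fun n => scalar_re (x n * scalar_conj (y n)))))
            (limn (series (fun n => scalar_im (x n * scalar_conj (y n))))).

(** Absolute convergence, since [|a b| <= |a|^2 + |b|^2]; [p] is later the real or the imaginary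
    part. *)
Lemma ip_cvg (p : K -> R) x y : (forall a : K, `|p a| <= rnorm a) ->
  cvgn (series (fun n => p (x n * scalar_conj (y n)))).
Proof.
move=> pn; apply: normed_cvg.
apply: (@series_le_cvg _ _ (fun n => rnorm (x n) ^+ 2 + rnorm (y n) ^+ 2)).
- by move=> n; exact: normr_ge0.
- by move=> n; rewrite addr_ge0 ?sqr_ge0.
- move=> n; apply: le_trans (pn _) _; rewrite rnormM rnorm_conj.
  have := rnorm_ge0 (x n); have := rnorm_ge0 (y n); nra.
rewrite [X in series X](_ : _ =
  (fun n => rnorm (x n) ^+ 2) + (fun n => rnorm (y n) ^+ 2)) //.
rewrite seriesD; apply: is_cvgD.
  by have := l2_valP x; rewrite inE.
by have := l2_valP y; rewrite inE.
Qed.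

Let rec x y := @ip_cvg _ x y (@normr_re_le R s).
Let imc x y := @ip_cvg _ x y (@normr_im_le R s).

Lemma ipDl x x' y : ip (x + x') y = ip x y + ip x' y.
Proof.
rewrite /ip -scalar_mkD -(lim_seriesD (@rec x y) (@rec x' y)).
rewrite -(lim_seriesD (@imc x y) (@imc x' y)).
congr (scalar_mk (limn (series _)) (limn (series _))); apply/funext => n;
  by rewrite /= mulrDl ?scalar_reD ?scalar_imD.
Qed.

Lemma ipZl (a : K) x y : ip (a *: x) y = a * ip x y.
Proof.
have axE n : (a *: x) n * scalar_conj (y n) = a * (x n * scalar_conj (y n)).
  exact: esym (mulrA _ _ _).
have limZ (b c : R) (f g : nat -> R) : cvgn (series f) -> cvgn (series g) ->
    limn (series (fun n => b * f n + c * g n)) = b * limn (series f) + c * limn (series g).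
  move=> cf cg; rewrite (_ : (fun n => _) = (b *: f : nat -> R) + (c *: g : nat -> R)) //.
  have [bf cg'] := (@is_cvg_seriesZ _ f b cf, @is_cvg_seriesZ _ g c cg).
  by rewrite (lim_seriesD bf cg') !lim_seriesZ.
rewrite /ip mulr_scalar_mk -mulNr.
rewrite -(limZ _ _ _ _ (@rec x y) (@imc x y)) -(limZ _ _ _ _ (@imc x y) (@rec x y)).
congr (scalar_mk (limn (series _)) (limn (series _))); apply/funext => n;
  by rewrite axE ?(scalar_reM a) ?(scalar_imM a) ?mulNr.
Qed.

Lemma ip_conj x y : ip y x = scalar_conj (ip x y).
Proof.
rewrite /ip scalar_conj_mk -lim_seriesN //.
congr (scalar_mk (limn (series _)) (limn (series _))); apply/funext => n /=.
  by rewrite -[RHS]scalar_re_conj scalar_conjM scalar_conjK mulrC.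
by rewrite -[LHS]opprK -scalar_im_conj scalar_conjM scalar_conjK mulrC.
Qed.

Lemma ipxx x : ip x x = scalar_of s (rnorm x ^+ 2).
Proof.
rewrite /ip (_ : (fun n => scalar_im _) = fun=> 0); last first.
  by apply/funext => n; rewrite mulr_conj scalar_im_of.
rewrite (_ : limn (series (fun=> 0)) = 0); last first.
  apply/cvg_lim => //; rewrite (_ : series _ = fun=> 0); first exact: cvg_cst.
  by apply/funext => n; rewrite /series /= big1.
rewrite scalar_mk0 rnorm_l2 sqr_sqrtr.
  by congr (scalar_of _ (limn (series _))); apply/funext => n; rewrite mulr_conj scalar_re_of.
have cx : cvgn (series (fun n => rnorm (x n) ^+ 2)).
  by have := l2_valP x; rewrite inE.
apply: le_trans (nonneg_series_le_lim 0 (fun n => sqr_ge0 (rnorm (x n))) cx).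
by rewrite /series /= big_geq.
Qed.

Definition ipr y x : K^o := ip x y.

Lemma ipr_linear y : linear (ipr y).
Proof. by move=> a x z; rewrite /ipr ipDl ipZl. Qed.

HB.instance Definition _ y := GRing.isLinear.Build K H K^o *:%R (ipr y) (ipr_linear y).

Lemma ip_suml (I : Type) (r : seq I) (P : pred I) (F : I -> H) y :
  ip (\sum_(i <- r | P i) F i) y = \sum_(i <- r | P i) ip (F i) y.
Proof. exact: (linear_sum (ipr y)). Qed.

Lemma ipBl x x' y : ip (x - x') y = ip x y - ip x' y.
Proof. exact: (linearB (ipr y)). Qed.

Lemma rnorm_pythagoras x y : ip x y = 0 ->
  rnorm (x + y) ^+ 2 = rnorm x ^+ 2 + rnorm y ^+ 2.
Proof.
move=> xy; apply: (can_inj (@scalar_ofK R s)); rewrite scalar_ofD -!ipxx.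
rewrite ipDl ip_conj ipDl [ip y (x + y)]ip_conj ipDl.
by rewrite [ip y x]ip_conj xy scalar_conj0 add0r addr0 -!ip_conj.
Qed.

(** Only the first [d] terms are constrained, so a family is extended by overwriting the term of
    index [d]. *)
Definition orthonormal_seq d (e : nat -> H) : Prop :=
  forall i j, (i < d)%N -> (j < d)%N -> ip (e i) (e j) = (i == j)%:R.

Definition proj d (e : nat -> H) x : H := \sum_(i < d) ip x (e i) *: e i.

Lemma proj_linear d e : linear (proj d e).
Proof.
move=> a x y; rewrite /proj scaler_sumr -big_split; apply: eq_bigr => i _.
by rewrite ipDl ipZl scalerDl scalerA.
Qed.

HB.instance Definition _ d e :=
  GRing.isLinear.Build K H H *:%R (proj d e) (proj_linear d e).

Lemma spanned_proj d e : spanned (proj d e) d.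
Proof.
exists (fun i => e i) => _ [x _ <-]; by exists (fun i : 'I_d => ip x (e i)).
Qed.

Section Orthonormal.
Variables (d : nat) (e : nat -> H).
Hypothesis eo : orthonormal_seq d e.

Lemma ip_comb (c : 'I_d -> K) (j : 'I_d) : ip (\sum_(i < d) c i *: e i) (e j) = c j.
Proof.
rewrite ip_suml (bigD1 j) //= ipZl eo // eqxx mulr1 big1 ?addr0 // => i ij.
by rewrite ipZl eo // (negbTE (_ : i != j :> nat)) // mulr0.
Qed.

Lemma rnorm_comb (c : 'I_d -> K) :
  rnorm (\sum_(i < d) c i *: e i) ^+ 2 = \sum_(i < d) rnorm (c i) ^+ 2.
Proof.
apply: (can_inj (@scalar_ofK R s)); rewrite -ipxx.
have -> : ip (\sum_(i < d) c i *: e i) (\sum_(i < d) c i *: e i) =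
    \sum_(i < d) c i * scalar_conj (c i).
  rewrite {1}ip_suml; apply: eq_bigr => i _.
  by rewrite ipZl ip_conj ip_comb.
rewrite (big_morph _ (@scalar_ofD R s) (@scalar_of0 R s)).
by apply: eq_bigr => i _; rewrite mulr_conj.
Qed.

Lemma ip_sub_proj x j : (j < d)%N -> ip (x - proj d e x) (e j) = 0.
Proof.
by move=> jd; rewrite ipBl (ip_comb (fun i => ip x (e i)) (Ordinal jd)) subrr.
Qed.

Lemma rnorm_proj x : rnorm x ^+ 2 =
  rnorm (x - proj d e x) ^+ 2 + \sum_(i < d) rnorm (ip x (e i)) ^+ 2.
Proof.
rewrite -rnorm_comb -rnorm_pythagoras ?subrK //.
rewrite ip_conj ip_suml big1 ?scalar_conj0 // => i _.
by rewrite ipZl [ip (e i) _]ip_conj ip_sub_proj // scalar_conj0 mulr0.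
Qed.

Lemma bessel x : \sum_(i < d) rnorm (ip x (e i)) ^+ 2 <= rnorm x ^+ 2.
Proof. by rewrite [leRHS]rnorm_proj lerDr sqr_ge0. Qed.

Lemma rnorm_sub_proj_le x : rnorm (x - proj d e x) <= rnorm x.
Proof.
rewrite -ler_sqr ?nnegrE ?rnorm_ge0 // [leRHS]rnorm_proj lerDl sumr_ge0 // => i _.
exact: sqr_ge0.
Qed.

Lemma rnorm_proj_le x : rnorm (proj d e x) <= rnorm x.
Proof.
rewrite -ler_sqr ?nnegrE ?rnorm_ge0 // rnorm_comb; exact: bessel.
Qed.

Lemma bounded_proj : bounded_op (proj d e).
Proof. by exists 1 => x; rewrite mul1r rnorm_proj_le. Qed.

Lemma rnorm_ip_le x i : (i < d)%N -> rnorm (ip x (e i)) <= rnorm x.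
Proof.
move=> id; rewrite -ler_sqr ?nnegrE ?rnorm_ge0 //; apply: le_trans (bessel x).
by rewrite (bigD1 (Ordinal id)) //= lerDl sumr_ge0 // => j _; exact: sqr_ge0.
Qed.

Lemma orthonormal_extend y : rnorm y = 1 ->
  (forall i, (i < d)%N -> ip y (e i) = 0) ->
  orthonormal_seq d.+1 (fun n => if n == d then y else e n).
Proof.
move=> y1 ye i j; rewrite !ltnS => id jd.
have [iE|idn] := eqVneq i d; have [jE|jdn] := eqVneq j d.
- by rewrite ipxx y1 expr1n scalar_of1 iE jE eqxx.
- by rewrite ye ?ltn_neqAle ?jdn // iE eq_sym (negbTE jdn).
- by rewrite ip_conj ye ?ltn_neqAle ?idn // scalar_conj0 jE (negbTE idn).
- by apply: eo; rewrite ltn_neqAle ?idn ?jdn.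
Qed.

End Orthonormal.
End InnerProduct.

(** * Finite sections in c0 and l1 *)

Section FiniteSections.
Context {R : realType} {s : scalar_kind}.
Local Notation K := (scalars R s).
Local Notation c0 := (c0 R s).
Local Notation l1 := (l1 R s).

Definition delta (n : nat) : nat -> K := fun i => (i == n)%:R.

Lemma delta_c0 n : delta n \in @c0_pred R s.
Proof.
rewrite inE /=; apply: cvg_near_cst; exists n.+1 => // i /= ni.
by rewrite /delta gtn_eqF.
Qed.

Lemma sum_delta_le n m : \sum_(0 <= i < m) rnorm (delta n i) <= 1.
Proof.
rewrite big_mkord; have [nm|mn] := ltnP n m; last first.
  by rewrite big1 // => i _; rewrite /delta ltn_eqF ?rnorm0 // (leq_trans _ mn).
rewrite (bigD1 (Ordinal nm)) //= big1 => [|i ni]; last first.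
  by rewrite /delta (negbTE (_ : (i : nat) != n)) ?rnorm0.
by rewrite /delta eqxx rnorm1 addr0.
Qed.

Lemma delta_l1 n : delta n \in @l1_pred R s.
Proof.
rewrite inE /=; apply: (nonneg_series_ub (M := 1) _ _).1 => m.
  exact: rnorm_ge0.
exact: sum_delta_le.
Qed.

Definition c0_delta n : c0 := C0 (delta_c0 n).
Definition l1_delta n : l1 := L1 (delta_l1 n).

Definition c0_fin N (c : 'I_N -> K) : c0 := \sum_(j < N) c j *: c0_delta j.
Definition l1_fin N (c : 'I_N -> K) : l1 := \sum_(j < N) c j *: l1_delta j.

Let fin_coord N (c : 'I_N -> K) n :
  \sum_(j < N) c j * delta j n = oapp c 0 (insub n).
Proof.
case: insubP => [i _ <-|] /=.
  rewrite (bigD1 i) //= /delta eqxx mulr1 big1 ?addr0 // => j ji.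
  by rewrite (negbTE (_ : (i : nat) != j)) ?mulr0 // eq_sym.
rewrite -leqNgt => Nn; rewrite big1 // => j _.
by rewrite /delta gtn_eqF ?mulr0 // (leq_trans _ Nn).
Qed.

Lemma c0_finE N (c : 'I_N -> K) n : c0_fin c n = oapp c 0 (insub n).
Proof.
rewrite -fin_coord.
exact: (big_morph (fun x : c0 => x n) (id1 := 0) (op1 := +%R)).
Qed.

Lemma l1_finE N (c : 'I_N -> K) n : l1_fin c n = oapp c 0 (insub n).
Proof.
rewrite -fin_coord.
exact: (big_morph (fun x : l1 => x n) (id1 := 0) (op1 := +%R)).
Qed.

Lemma rnorm_c0_le (x : c0) (M : R) :
  (forall n, rnorm (x n) <= M) -> rnorm x <= M.
Proof. by rewrite rnorm_c0; exact: c0_norm_le. Qed.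

Lemma rnorm_coord_c0 (x : c0) n : rnorm (x n) <= rnorm x.
Proof. by rewrite rnorm_c0 c0_norm_ub ?c0_valP. Qed.

Lemma rnorm_l1_le (x : l1) (M : R) :
  (forall n, \sum_(0 <= i < n) rnorm (x i) <= M) -> rnorm x <= M.
Proof.
by rewrite rnorm_l1 => xM; apply: (nonneg_series_ub _ xM).2 => n; exact: rnorm_ge0.
Qed.

Lemma sum_l1_le (x : l1) n : \sum_(0 <= i < n) rnorm (x i) <= rnorm x.
Proof.
rewrite rnorm_l1; apply: (@nonneg_series_le_lim R (fun n => rnorm (x n))).
  by move=> i; exact: rnorm_ge0.
by have := l1_valP x; rewrite inE.
Qed.

Lemma rnorm_l1_delta n : rnorm (l1_delta n) <= 1.
Proof. by apply: rnorm_l1_le => m; exact: sum_delta_le. Qed.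

Definition c0_trunc N (x : c0) : c0 := c0_fin (fun i : 'I_N => x i).
Definition l1_trunc N (x : l1) : l1 := l1_fin (fun i : 'I_N => x i).

Lemma c0_truncE N x n : c0_trunc N x n = if (n < N)%N then x n else 0.
Proof. by rewrite c0_finE; case: insubP => [i -> <- //|/negbTE ->]. Qed.

Lemma l1_truncE N x n : l1_trunc N x n = if (n < N)%N then x n else 0.
Proof. by rewrite l1_finE; case: insubP => [i -> <- //|/negbTE ->]. Qed.

Lemma l1_trunc_linear N : linear (l1_trunc N).
Proof.
move=> a x y; rewrite /l1_trunc /l1_fin scaler_sumr -big_split.
by apply: eq_bigr => i _ /=; rewrite scalerA -scalerDl.
Qed.

HB.instance Definition _ N :=
  GRing.isLinear.Build K l1 l1 *:%R (l1_trunc N) (l1_trunc_linear N).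

Lemma spanned_l1_trunc N : spanned (l1_trunc N) N.
Proof.
by exists (fun i => l1_delta i) => _ [x _ <-]; exists (fun i : 'I_N => x i).
Qed.

Lemma rnorm_l1_trunc N x : rnorm (l1_trunc N x) <= rnorm x.
Proof.
apply: rnorm_l1_le => n; apply: le_trans (sum_l1_le x n); apply: ler_sum => i _.
by rewrite l1_truncE; case: ifP => // _; rewrite rnorm0 rnorm_ge0.
Qed.

Lemma bounded_l1_trunc N : bounded_op (l1_trunc N).
Proof. by exists 1 => x; rewrite mul1r rnorm_l1_trunc. Qed.

Lemma c0_sub_trunc (x : c0) N n :
  (x - c0_trunc N x) n = if (n < N)%N then 0 else x n.
Proof.
transitivity (x n - c0_trunc N x n) => //.
by rewrite c0_truncE; case: ifP => _; rewrite ?subrr ?subr0.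
Qed.

Lemma l1_sub_trunc (x : l1) N n :
  (x - l1_trunc N x) n = if (n < N)%N then 0 else x n.
Proof.
transitivity (x n - l1_trunc N x n) => //.
by rewrite l1_truncE; case: ifP => _; rewrite ?subrr ?subr0.
Qed.

Lemma c0_trunc_cvg (x : c0) (e : R) : 0 < e ->
  \forall N \near \oo, rnorm (x - c0_trunc N x) <= e.
Proof.
move=> e0; have := c0_valP x; rewrite inE /= => /cvgr0Pnorm_lt xe.
have [|N0 _ xN0] := xe (scalar_of s e); first by case: (s) => //=; rewrite ltcR.
exists N0 => // N /= N0N; apply: rnorm_c0_le => n; rewrite c0_sub_trunc.
case: ltnP => [_|Nn]; first by rewrite rnorm0 ltW.
rewrite -(@ler_scalar_of R s) -rnormE; apply/ltW/xN0 => /=.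
exact: leq_trans Nn.
Qed.

Lemma l1_trunc_cvg (x : l1) (e : R) : 0 < e ->
  \forall N \near \oo, rnorm (x - l1_trunc N x) <= e.
Proof.
move=> e0; pose u n := rnorm (x n).
have cu : cvgn (series u) by have := l1_valP x; rewrite inE.
have := cu => /cvgrPdist_le/(_ e e0); apply: filterS => N uN.
apply: rnorm_l1_le => n.
under eq_bigr do rewrite l1_sub_trunc.
(* A partial sum of the tail is compared with a difference of partial sums of [u]; the maximum
   covers the case [n < N], where the tail sum is 0. *)
have tailE : \sum_(0 <= i < n) rnorm (if (i < N)%N then 0 else x i) + series u N <=
    series u (maxn n N).
  elim: n => [|n IH]; first by rewrite big_geq // add0r max0n.
  rewrite big_nat_recr //=; case: ltnP => [nN|Nn].
    by rewrite rnorm0 addr0 (maxn_idPr nN); rewrite (maxn_idPr (ltnW nN)) in IH.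
  rewrite (maxn_idPl (leqW Nn)); rewrite (maxn_idPl Nn) in IH.
  by rewrite addrAC seriesSr lerD2r.
have le := nonneg_series_le_lim (maxn n N) (fun i => rnorm_ge0 (x i)) cu.
have /ler_normlP[_ h] := uN.
by rewrite -/u in le; lra.
Qed.

Definition l1_fun (c : nat -> K) (m n : nat) (z : l1) : K^o :=
  \sum_(m <= i < n) c i * z i.

Lemma l1_fun_linear c m n : linear (l1_fun c m n).
Proof.
move=> a x y; rewrite /l1_fun scaler_sumr -big_split; apply: eq_bigr => i _ /=.
by transitivity (c i * (a * x i + y i)); rewrite // mulrDr mulrCA.
Qed.

HB.instance Definition _ c m n :=
  GRing.isLinear.Build K l1 K^o *:%R (l1_fun c m n) (l1_fun_linear c m n).

Lemma rnorm_l1_fun_le c m n (M : R) z : (forall i, rnorm (c i) <= M) ->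
  rnorm (l1_fun c m n z) <= M * rnorm z.
Proof.
move=> cM; have M0 : 0 <= M by apply: le_trans (cM 0%N); exact: rnorm_ge0.
apply: le_trans (ler_rnorm_sum _ _ _) _.
apply: (@le_trans _ _ (\sum_(m <= i < n) M * rnorm (z i))).
  by apply: ler_sum => i _; rewrite rnormM ler_wpM2r ?rnorm_ge0.
rewrite -mulr_sumr ler_wpM2l //; apply: le_trans (sum_l1_le z n).
have [mn|/ltnW nm] := leqP m n.
  rewrite (big_cat_nat (leq0n m) mn) //= lerDr sumr_ge0 // => i _; exact: rnorm_ge0.
by rewrite big_geq // sumr_ge0 // => i _; exact: rnorm_ge0.
Qed.

Lemma l1_fun_delta c m n i :
  l1_fun c m n (l1_delta i) = if (m <= i < n)%N then c i else 0.
Proof.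
rewrite /l1_fun /=; case: ifP => [/[dup] mn /andP[mi ni]|mn].
  rewrite (big_cat_nat mi (ltnW ni)) /= [X in X + _]big_nat big1 => [|j /andP[_ ji]].
    rewrite add0r big_ltn // /delta eqxx mulr1 big_nat big1 ?addr0 // => j /andP[ij _].
    by rewrite gtn_eqF ?mulr0.
  by rewrite /delta ltn_eqF ?mulr0.
rewrite big_nat big1 // => j jmn; rewrite /delta; case: eqP => [ji|]; last by rewrite mulr0.
by rewrite ji mn in jmn.
Qed.

(** The norm is a supremum of partial sums, so a finite window already exceeds [e]; phases of the
    coordinates turn its absolute values into a functional. *)
Lemma l1_norming (y : l1) n (e : R) : 0 <= e -> e < rnorm (y - l1_trunc n y) ->
  exists N (c : nat -> K), [/\ (n <= N)%N, forall i, rnorm (c i) <= 1 &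
    e < scalar_re (l1_fun c n N y)].
Proof.
move=> e0 ey; have [N eN] : exists N, e < \sum_(0 <= i < N) rnorm ((y - l1_trunc n y) i).
  apply: contrapT => /forallNP yN; move: ey; rewrite ltNge => /negP; apply.
  by apply: rnorm_l1_le => N; rewrite leNgt; apply/negP/yN.
move: eN; under eq_bigr do rewrite l1_sub_trunc; move=> eN.
(* A window ending before [n] would sum to 0, which does not exceed [e]. *)
have nN : (n <= N)%N.
  rewrite leqNgt; apply/negP => Nn; move: eN; rewrite ltNge big_nat big1 ?e0 //.
  by move=> i /andP[_ iN]; rewrite (ltn_trans iN Nn) rnorm0.
have [c c1 cE] : exists2 c : nat -> K, forall i, rnorm (c i) <= 1 &
    forall i, scalar_re (c i * y i) = rnorm (y i).
  have /choice[c cP] i : exists c : K, rnorm c <= 1 /\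
      scalar_re (c * y i) = rnorm (y i).
    by have [c] := scalar_phase (y i); exists c.
  by exists c => i; case: (cP i).
exists N, c; split=> //; apply: (lt_le_trans eN).
rewrite scalar_re_sum (big_cat_nat (leq0n n) nN) //= [X in X + _]big_nat.
rewrite big1 ?add0r => [|i /andP[_ i_n]].
  rewrite !big_nat; apply: ler_sum => i /andP[ni _]; by rewrite cE ltnNge ni.
by rewrite i_n rnorm0.
Qed.

End FiniteSections.

(** * Grothendieck's inequality for operators from c0 to l1 *)

Section OperatorGrothendieck.
Context {R : realType} {s : scalar_kind}.
Local Notation K := (scalars R s).
Local Notation c0 := (c0 R s).
Local Notation l1 := (l1 R s).

Definition scalar_unit (a : bool) : K := if a then scalar_i else 1.
Definition scalar_part (z : K) (a : bool) : R := if a then scalar_im z else scalar_re z.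

Lemma scalar_part_sqr_le z a : scalar_part z a ^+ 2 <= rnorm z ^+ 2.
Proof. by rewrite rnorm_sqr /scalar_part; case: a; rewrite ?lerDl ?lerDr sqr_ge0. Qed.

Lemma sum_scalar_unit (f : bool -> R) :
  \sum_a scalar_of s (f a) * scalar_unit a = scalar_mk (f false) (f true).
Proof.
rewrite big_bool /= /scalar_unit /scalar_mk mulr1 addrC; congr (_ + _).
exact: mulrC.
Qed.

Lemma rnorm_scalar_mk_le (a b : R) : rnorm (scalar_mk a b : K) <= `|a| + `|b|.
Proof.
apply: le_trans (ler_rnormD _ _) _; rewrite rnormM !rnorm_of lerD2l.
by rewrite ler_piMl // rnorm_i.
Qed.

Variable T : {linear c0 -> l1}.
Hypothesis Tb : bounded_op T.

Definition entry (i j : nat) : K := T (c0_delta j) i.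

(** The real part of an [N] by [N] section of the form of [T], as a real matrix in twice as many
    coordinates: the boolean selects real or imaginary part. *)
Definition real_entry N (p q : 'I_N * bool) : R :=
  scalar_re (entry p.1 q.1 * (scalar_unit p.2 * scalar_unit q.2)).

Lemma bilin_real_entry N (x y : 'I_N * bool -> R) :
  bilin (real_entry (N := N)) x y = scalar_re (\sum_(i < N) \sum_(j < N) entry i j *
    (scalar_mk (x (i, false)) (x (i, true)) * scalar_mk (y (j, false)) (y (j, true)))).
Proof.
rewrite scalar_re_sum /bilin.
have sum_pair (F : 'I_N * bool -> R) : \sum_p F p = \sum_i \sum_a F (i, a).
  by rewrite pair_bigA; apply: eq_bigr => -[].
rewrite sum_pair; apply: eq_bigr => i _.
under eq_bigr do rewrite sum_pair.
rewrite exchange_big scalar_re_sum; apply: eq_bigr => j _ /=.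
rewrite -(sum_scalar_unit (fun a => x (i, a))) -(sum_scalar_unit (fun b => y (j, b))).
rewrite mulr_suml mulr_sumr scalar_re_sum; apply: eq_bigr => a _.
rewrite mulr_sumr mulr_sumr scalar_re_sum; apply: eq_bigr => b _.
rewrite /real_entry /=.
set e := entry _ _; set u := scalar_unit a; set v := scalar_unit b.
have -> : e * (scalar_of s (x (i, a)) * u * (scalar_of s (y (j, b)) * v)) =
    scalar_of s (x (i, a) * y (j, b)) * (e * (u * v)) by rewrite scalar_ofM; ring.
by rewrite [RHS]scalar_reM scalar_re_of scalar_im_of mul0r subr0 mulrC.
Qed.

Lemma sum_entry N (b : nat -> K) (c : 'I_N -> K) :
  l1_fun b 0 N (T (c0_fin c)) = \sum_(i < N) \sum_(j < N) entry i j * (b i * c j).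
Proof.
rewrite /l1_fun big_mkord; apply: eq_bigr => i _.
rewrite /c0_fin linear_sum; under eq_bigr do rewrite linearZ.
rewrite (_ : (\sum_j _ : l1) i = \sum_j c j * entry i j); last first.
  exact: (big_morph (fun x : l1 => x i) (id1 := 0) (op1 := +%R)).
by rewrite mulr_sumr; apply: eq_bigr => j _; rewrite mulrA mulrC.
Qed.

(** Two real coordinates of modulus at most 1 make a scalar of modulus at most 2, on each side;
    whence the factor 4, and the final [32 = 8 * 4]. *)
Lemma bilin_real_entry_le N (x y : 'I_N * bool -> R) :
  (forall p, `|x p| <= 1) -> (forall q, `|y q| <= 1) ->
  bilin (real_entry (N := N)) x y <= 4 * opnorm T.
Proof.
move=> x1 y1; rewrite bilin_real_entry.
pose b i : K := oapp (fun i : 'I_N => scalar_mk (x (i, false)) (x (i, true))) 0 (insub i).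
pose c (j : 'I_N) : K := scalar_mk (y (j, false)) (y (j, true)).
have -> : \sum_(i < N) \sum_(j < N) entry i j * (scalar_mk (x (i, false)) (x (i, true)) *
    scalar_mk (y (j, false)) (y (j, true))) = l1_fun b 0 N (T (c0_fin c)).
  by rewrite sum_entry; apply: eq_bigr => i _; rewrite /b valK.
have mk2 (f : 'I_N * bool -> R) i : (forall p, `|f p| <= 1) ->
    rnorm (scalar_mk (f (i, false)) (f (i, true)) : K) <= 2.
  by move=> f1; apply: le_trans (rnorm_scalar_mk_le _ _) _; rewrite -[2]/(1 + 1) lerD.
have b2 i : rnorm (b i) <= 2.
  by rewrite /b; case: insubP => [j _ _|_] /=; [exact: mk2|rewrite rnorm0].
have c2 : rnorm (c0_fin c) <= 2.
  apply: rnorm_c0_le => n; rewrite c0_finE; case: insubP => [j _ _|_] /=.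
    exact: mk2.
  by rewrite rnorm0.
apply: le_trans (re_le_rnorm _) _; apply: le_trans (rnorm_l1_fun_le _ _ _ b2) _.
rewrite (_ : 4 = 2 * 2 :> R); last by ring.
rewrite -mulrA ler_pM2l // (le_trans (rnorm_le_opnorm _ Tb)) // mulrC.
by rewrite ler_wpM2r // opnorm_ge0.
Qed.

Lemma functional_bound (phi : {linear l1 -> K^o}) : bounded_op phi ->
  exists2 C : R, 0 < C & forall z, rnorm (phi z : K) <= C * rnorm z.
Proof.
move=> [C phiC]; exists (`|C| + 1); first by rewrite ltr_wpDl.
move=> z; apply: le_trans (phiC z) _; rewrite ler_wpM2r ?rnorm_ge0 //.
by rewrite ler_wpDr // ler_norm.
Qed.

(** The real inequality applies to finite sections, truncated in both source and target; truncations
    converge in norm in [c0] and [l1], and finitely many indices [m] admit a common [N]. *)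
Lemma operator_grothendieck d (x : 'I_d -> c0) (phi : 'I_d -> {linear l1 -> K^o})
    (A B : R) : 0 < A -> 0 < B -> (forall m, bounded_op (phi m)) ->
  (forall j, \sum_m rnorm (x m j) ^+ 2 <= A ^+ 2) ->
  (forall i, \sum_m rnorm (phi m (l1_delta i) : K) ^+ 2 <= B ^+ 2) ->
  \sum_m scalar_re (phi m (T (x m)) : K) <= 32 * opnorm T * (A * B).
Proof.
move=> A0 B0 phib xA phiB.
have fin N : \sum_m scalar_re (phi m (l1_trunc N (T (c0_trunc N (x m)))) : K) <=
    32 * opnorm T * (A * B).
  pose f m (p : 'I_N * bool) := scalar_part (phi m (l1_delta p.1)) p.2.
  pose g m (q : 'I_N * bool) := scalar_part (x m q.1) q.2.
  rewrite (eq_bigr (fun m => bilin (real_entry (N := N)) (f m) (g m))); last first.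
    move=> m _; rewrite bilin_real_entry; congr scalar_re.
    rewrite /f /g /=; under [RHS]eq_bigr do under eq_bigr do rewrite !scalar_mkK.
    have := sum_entry (fun i => phi m (l1_delta i)) (fun j : 'I_N => x m j).
    rewrite -/(c0_trunc N (x m)) => <-.
    rewrite /l1_fun big_mkord /l1_trunc /l1_fin linear_sum; apply: eq_bigr => i _.
    by rewrite linearZ /= mulrC.
  have := @grothendieck_inequality _ _ _ _ _ (@bilin_real_entry_le N) _
    (index_enum 'I_d) f g B A B0 A0 _ _.
  rewrite (_ : 8 * _ * (B * A) = 32 * opnorm T * (A * B)); last by ring.
  apply=> p.
    by apply: le_trans (phiB p.1); apply: ler_sum => m _; exact: scalar_part_sqr_le.
  by apply: le_trans (xA p.1); apply: ler_sum => m _; exact: scalar_part_sqr_le.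
have nT : 0 <= opnorm T by exact: opnorm_ge0.
apply/ler_addgt0Pr => e e0.
(* The error [e] is shared among [d.+1] terms, as [d] may be 0. *)
have dn0 : 0 < d.+1%:R :> R by rewrite ltr0n.
have near m : \forall N \near \oo, scalar_re (phi m (T (x m)) : K) -
    scalar_re (phi m (l1_trunc N (T (c0_trunc N (x m)))) : K) <= e / d.+1%:R.
  have [C C0 phiC] := functional_bound (phib m).
  (* Chosen so that [C * (r + opnorm T * r)] is exactly [e / d.+1%:R]. *)
  pose r := e / d.+1%:R / (C * (1 + opnorm T)).
  have r0 : 0 < r by rewrite !divr_gt0 // mulr_gt0 // ltr_pwDl.
  have := l1_trunc_cvg (T (x m)) r0; have := c0_trunc_cvg (x m) r0.
  apply: filterS2 => N xr Tr.
  have TE : T (x m) = (T (x m) - l1_trunc N (T (x m)) +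
      l1_trunc N (T (x m - c0_trunc N (x m)))) + l1_trunc N (T (c0_trunc N (x m))).
    by rewrite -addrA -linearD -linearD !subrK.
  rewrite {1}TE linearD scalar_reD addrK.
  apply: le_trans (re_le_rnorm _) _; apply: le_trans (phiC _) _.
  apply: (@le_trans _ _ (C * (r + opnorm T * r))).
    rewrite ler_pM2l //; apply: le_trans (ler_rnormD _ _) _; rewrite lerD //.
    apply: le_trans (rnorm_l1_trunc _ _) _.
    by apply: le_trans (rnorm_le_opnorm _ Tb) _; rewrite ler_wpM2l.
  rewrite -{1}[r]mul1r -mulrDl mulrA mulrC /r divfK //.
  by rewrite gt_eqF // mulr_gt0 // ltr_pwDl.
have [N nearN] : exists N, forall m, scalar_re (phi m (T (x m)) : K) -
    scalar_re (phi m (l1_trunc N (T (c0_trunc N (x m)))) : K) <= e / d.+1%:R.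
  by have [N _ /(_ N (leqnn N)) nearN] := filter_forall _ near; exists N.
rewrite -lerBlDl; apply: le_trans (_ : _ <= \sum_(m < d) e / d.+1%:R) _.
  rewrite lerBlDr; apply: le_trans (lerD (lexx _) (fin N)).
  by rewrite -big_split; apply: ler_sum => m _ /=; rewrite -lerBlDr.
rewrite sumr_const card_ord -[_ *+ d]mulr_natr mulrAC ler_pdivrMr //.
by rewrite ler_pM2l // ler_nat.
Qed.

(* If the tails of T did not vanish, we could choose x m in the unit ball such
   that the tails of the T (x m) are large on disjoint blocks; the functionals
   norming these blocks would contradict the Grothendieck inequality. *)
Lemma opnorm_sub_trunc_small (e : R) : 0 < e ->
  exists N, opnorm (fun x => T x - l1_trunc N (T x)) <= e.
Proof.
move=> e0; apply: contrapT => /forallNP Te.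
have step N : exists t : c0 * nat * (nat -> K), [/\ rnorm t.1.1 <= 1,
    (N <= t.1.2)%N, forall i, rnorm (t.2 i) <= 1 &
    e < scalar_re (l1_fun t.2 N t.1.2 (T t.1.1) : K)].
  have [x x1 ex] : exists2 x, rnorm x <= 1 & e < rnorm (T x - l1_trunc N (T x)).
    apply: contrapT => xN; apply: (Te N); apply: opnorm_le => x x1.
    by rewrite leNgt; apply/negP => ex; apply: xN; exists x.
  have [n [c [Nn c1 ec]]] := l1_norming (ltW e0) ex.
  by exists (x, n, c).
have [t tP] := choice step.
(* Block [m] runs from [n m] to [n m.+1]: each vector is chosen with respect to the tail beyond the
   previous window. *)
pose n := fix n m := if m is m'.+1 then (t (n m')).1.2 else 0%N.
pose phi m : {linear l1 -> K^o} := l1_fun (t (n m)).2 (n m) (n m.+1).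
(* [A] is the root of [d.+1] to remain positive for [d = 0]; [B = 1] because the blocks are
   disjoint. *)
have bound d : d%:R * e <= 32 * opnorm T * (Num.sqrt d.+1%:R * 1).
  have := @operator_grothendieck d (fun m => (t (n m)).1.1) phi (Num.sqrt d.+1%:R) 1.
  rewrite sqrtr_gt0 ltr0n => /(_ isT ltr01) h.
  apply: le_trans (h _ _ _) => [|m|j|i].
  - rewrite mulrC mulr_natr -[X in _ *+ X]card_ord -sumr_const ler_sum // => m _.
    by apply: ltW; case: (tP (n m)).
  - exists 1 => z; apply: rnorm_l1_fun_le; by case: (tP (n m)).
  - rewrite sqr_sqrtr ?ler0n //; apply: (@le_trans _ _ (\sum_(m < d) 1)).
      apply: ler_sum => m _; rewrite expr_le1 ?rnorm_ge0 //.
      by apply: le_trans (rnorm_coord_c0 _ _) _; case: (tP (n m)).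
    by rewrite sumr_const card_ord ler_nat.
  (* The sharper bound, 0 for indices not below [n d], lets the induction add the next block. *)
  - rewrite expr1n; apply: (@le_trans _ _ (i < n d)%N%:R); last by rewrite lern1 leq_b1.
    elim: d {h} => [|d IH]; first by rewrite big_ord0.
    rewrite big_ord_recr /= l1_fun_delta.
    have nd : (n d <= n d.+1)%N by case: (tP (n d)).
    have [id|di] /= := ltnP i (n d).
      by rewrite rnorm0 expr0n addr0 (leq_trans id nd) (le_trans IH) // id.
    rewrite ltnNge di /= in IH; apply: (le_trans (lerD IH (lexx _))).
    rewrite add0r -/(n d.+1); case: ltnP => _; last by rewrite rnorm0 expr0n.
    by rewrite expr_le1 ?rnorm_ge0 //; case: (tP (n d)).
have nT : 0 <= opnorm T by exact: opnorm_ge0.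
(* As [q ^+ 2 = d + 1 <= 2 * d], the bound gives [q <= 64 * opnorm T / e], hence [d + 1 <= r - 1],
   against [r <= d]. *)
pose r := (64 * opnorm T / e) ^+ 2 + 1.
pose d := Num.bound r; have := bound d.
have rd : r <= d%:R by rewrite ltW // archi_boundP // addr_ge0 ?sqr_ge0.
have d1 : 1 <= d%:R :> R by apply: le_trans rd; rewrite /r lerDr sqr_ge0.
set q := Num.sqrt _; have q2 : q ^+ 2 = d.+1%:R by rewrite sqr_sqrtr ?ler0n.
have q0 : 0 < q by rewrite sqrtr_gt0 ltr0n.
rewrite mulr1 => dq; move: rd; rewrite leNgt => /negP; apply.
rewrite -natr1 in q2; have qd : q ^+ 2 <= 2 * d%:R by lra.
have qT : q <= 64 * opnorm T / e.
  by rewrite ler_pdivlMr // -(ler_pM2l q0); nra.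
rewrite /r; have : q ^+ 2 <= (64 * opnorm T / e) ^+ 2.
  by rewrite ler_sqr // nnegrE ?(ltW q0) // (le_trans (ltW q0)).
by lra.
Qed.

End OperatorGrothendieck.

(** * Greedy choice of orthonormal families *)

Section Greedy.
Context {R : realType} {s : scalar_kind}.
Local Notation K := (scalars R s).
Local Notation H := (l2 R s).
Implicit Types X Y : normedModType K.

(** Since [m] may be below [d], the negation excludes all smaller ranks too, as every stage of a
    greedy choice requires. *)
Definition approximable X Y (W : X -> Y) (d : nat) (e : R) : Prop :=
  exists S : {linear X -> Y}, exists m : nat,
    [/\ bounded_op S, spanned S m, (m <= d)%N &
      forall x, rnorm x <= 1 -> rnorm (W x - S x) <= e].

Lemma approx_approximable X Y (T F W : {linear X -> Y}) n N d (e : R) :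
  bounded_op T -> bounded_op F -> spanned F N -> (forall x, T x = F x + W x) ->
  approximable W d e -> (N + d < n)%N -> approx n T <= e.
Proof.
move=> Tb Fb FN TE [S [m [Sb Sm md Se]]] Nd.
apply: (@approx_le _ _ _ _ T (F \+ S) n (N + m)) => //.
- exact: bounded_opD.
- exact: spannedD.
- by apply: leq_ltn_trans Nd; rewrite leq_add2l.
- by move=> x x1; rewrite TE /= opprD addrACA subrr add0r; exact: Se.
Qed.

Lemma not_approximable X Y (W : X -> Y) d (e : R) (S : {linear X -> Y}) m :
  ~ approximable W d e -> bounded_op S -> spanned S m -> (m <= d)%N ->
  exists2 x, rnorm x <= 1 & e < rnorm (W x - S x).
Proof.
move=> We Sb Sm md; apply: contrapT => Sx; apply: We; exists S, m; split=> // x x1.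
by rewrite leNgt; apply/negP => ex; apply: Sx; exists x.
Qed.

Definition normalize X (x : X) : X := scalar_of s (rnorm x)^-1 *: x.

Lemma rnorm_normalize X (x : X) : 0 < rnorm x -> rnorm (normalize x) = 1.
Proof.
by move=> x0; rewrite rnormZ rnorm_of gtr0_norm ?invr_gt0 // mulVf // gt_eqF.
Qed.

Lemma ip_normalize (x : H) : ip x (normalize x) = scalar_of s (rnorm x).
Proof.
rewrite ip_conj ipZl ipxx -scalar_ofM -scalar_mk0 scalar_conj_mk oppr0 scalar_mk0.
have [->|x0] := eqVneq (rnorm x) 0; first by rewrite expr0n mulr0.
by rewrite expr2 mulKf.
Qed.

(** A Gram-Schmidt step: the new vector is orthogonal to the projection of [x], so it pairs with [x]
    as with [z]. *)
Lemma orthonormal_extend_normalize d (e : nat -> H) x :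
  let z := x - proj d e x in orthonormal_seq d e -> 0 < rnorm z ->
  orthonormal_seq d.+1 (fun n => if n == d then normalize z else e n) /\
  ip x (normalize z) = scalar_of s (rnorm z).
Proof.
move=> z eo z0; have ze i : (i < d)%N -> ip (normalize z) (e i) = 0.
  by move=> id; rewrite ipZl ip_sub_proj // mulr0.
split; first by apply: orthonormal_extend => //; exact: rnorm_normalize.
rewrite -[x in LHS](subrK (proj d e x)) -/z ipDl ip_normalize ip_suml big1 ?addr0 // => i _.
by rewrite ipZl [ip (e i) _]ip_conj ze // scalar_conj0 mulr0.
Qed.

(** At stage [m] the competitor is [W \o proj m x], so some [z] has a residue [w] orthogonal to the
    family with [W w] larger than [e]; [w] has norm at most 1, and normalising it only helps. *)
Lemma greedy_domain Y (W : {linear H -> Y}) d (e : R) : bounded_op W -> 0 <= e ->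
  ~ approximable W d e -> exists x : nat -> H,
    orthonormal_seq d x /\ forall i, (i < d)%N -> e < rnorm (W (x i)).
Proof.
(* Induction on the length of the family, while [We] keeps the full [d]. *)
move=> Wb e0 We; elim: {-2}d (leqnn d) => [|m IH] md.
  by exists (fun=> 0); split.
have [x [xo xe]] := IH (ltnW md).
have [||z z1] := not_approximable (S := W \o proj m x) (m := m) We _ _ (ltnW md).
- by have [] := bounded_comp (bounded_proj xo) Wb.
- exact/spanned_comp/spanned_proj.
rewrite /= -linearB; set w := z - _ => we.
have w0 : 0 < rnorm w.
  rewrite lt_neqAle rnorm_ge0 andbT eq_sym; apply/eqP => /rnorm_eq0 w0.
  by move: we; rewrite w0 linear0 rnorm0 ltNge e0.
have [wo _] := orthonormal_extend_normalize xo w0.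
exists (fun n => if n == m then normalize w else x n); split=> // i.
rewrite ltnS leq_eqVlt; case: eqVneq => [_ _|_ /= im]; last exact: xe.
rewrite linearZ rnormZ rnorm_of gtr0_norm ?invr_gt0 // mulrC ltr_pdivlMr //.
apply: le_lt_trans we; rewrite ler_piMr //.
by rewrite (le_trans (rnorm_sub_proj_le xo z)).
Qed.

(** Here the competitor is [proj m y \o W], and the normalised residue of [W z] is the next [y]. The
    vectors [x] are merely in the unit ball. *)
Lemma greedy_range X (W : {linear X -> H}) d (e : R) : bounded_op W -> 0 <= e ->
  ~ approximable W d e -> exists (x : nat -> X) (y : nat -> H),
    orthonormal_seq d y /\ forall i, (i < d)%N ->
      rnorm (x i) <= 1 /\ e < scalar_re (ip (W (x i)) (y i)).
Proof.
move=> Wb e0 We; elim: {-2}d (leqnn d) => [|m IH] md.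
  by exists (fun=> 0), (fun=> 0); split.
have [x [y [yo xye]]] := IH (ltnW md).
have [||z z1 /= ze] := not_approximable (S := proj m y \o W) (m := m) We _ _ (ltnW md).
- by have [] := bounded_comp Wb (bounded_proj yo).
- exact/spanned_precomp/spanned_proj.
have [wo wz] := orthonormal_extend_normalize yo (le_lt_trans e0 ze).
exists (fun n => if n == m then z else x n),
  (fun n => if n == m then normalize (W z - proj m y (W z)) else y n).
split=> // i.
rewrite ltnS leq_eqVlt; case: eqVneq => [_ _|_ /= im]; last exact: xye.
by rewrite wz scalar_re_of.
Qed.

(** The competitor [S1 \+ S2] leaves the residue [(1 - Q) W (1 - P)], with [P] and [Q] the
    projections onto the two families. It costs twice the rank, hence [d + d]. *)
Lemma greedy_both (W : {linear H -> H}) d (e : R) : bounded_op W -> 0 <= e ->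
  ~ approximable W (d + d) e -> exists (x y : nat -> H),
    [/\ orthonormal_seq d x, orthonormal_seq d y &
      forall i, (i < d)%N -> e < scalar_re (ip (W (x i)) (y i))].
Proof.
move=> Wb e0 We; elim: {-2}d (leqnn d) => [|m IH] md.
  by exists (fun=> 0), (fun=> 0); split.
have [x [y [xo yo xye]]] := IH (ltnW md).
pose S1 : {linear H -> H} := W \o proj m x.
pose S2 : {linear H -> H} := proj m y \o (W \- S1).
have S1b : bounded_op S1 by have [] := bounded_comp (bounded_proj xo) Wb.
have [||z z1] := not_approximable (S := S1 \+ S2) (m := (m + m)%N) We _ _
  (leq_add (ltnW md) (ltnW md)).
- apply: bounded_opD => //.
  have Db : bounded_op (W \- S1 : {linear H -> H}) := bounded_opB Wb S1b.
  by have [] := bounded_comp Db (bounded_proj yo).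
- apply: spannedD; first exact/spanned_comp/spanned_proj.
  exact/spanned_precomp/spanned_proj.
rewrite /= opprD addrA -linearB; set t := z - _; set w := _ - proj m y _ => we.
have t0 : 0 < rnorm t.
  rewrite lt_neqAle rnorm_ge0 andbT eq_sym; apply/eqP => /rnorm_eq0 t0.
  by move: we; rewrite /w t0 linear0 linear0 subr0 rnorm0 ltNge e0.
have [to _] := orthonormal_extend_normalize xo t0.
have [wo wt] := orthonormal_extend_normalize yo (le_lt_trans e0 we).
exists (fun n => if n == m then normalize t else x n),
  (fun n => if n == m then normalize w else y n); split=> // i.
rewrite ltnS leq_eqVlt; case: eqVneq => [_ _|_ /= im]; last exact: xye.
rewrite linearZ ipZl wt -scalar_ofM scalar_re_of mulrC ltr_pdivlMr //.
apply: le_lt_trans we; rewrite ler_piMr //.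
by rewrite (le_trans (rnorm_sub_proj_le xo z)).
Qed.

End Greedy.

(** * Weyl, Chang and Hilbert numbers *)

Section SNumbers.
Context {R : realType} {s : scalar_kind}.
Local Notation K := (scalars R s).
Local Notation H := (l2 R s).
Local Notation c0 := (c0 R s).
Local Notation l1 := (l1 R s).

(** Duality: the combination [z] with conjugate coefficients has squared norm [a], and coordinate
    [j] of [u z] is [a]; so [a] is at most [opnorm u] times its own root. *)
Lemma sum_coord_le (u : {linear H -> c0}) d (x : nat -> H) j : bounded_op u ->
  orthonormal_seq d x -> \sum_(m < d) rnorm (u (x m) j) ^+ 2 <= opnorm u ^+ 2.
Proof.
move=> ub xo; set a := (X in X <= _).
pose c (m : 'I_d) : K := scalar_conj (u (x m) j).
pose z := \sum_(m < d) c m *: x m.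
have za : rnorm z ^+ 2 = a.
  by rewrite rnorm_comb //; apply: eq_bigr => m _; rewrite rnorm_conj.
have uz : u z j = scalar_of s a.
  rewrite /z linear_sum; under eq_bigr do rewrite linearZ.
  rewrite (_ : (\sum_m _ : c0) j = \sum_m c m * u (x m) j); last first.
    exact: (big_morph (fun x : c0 => x j) (id1 := 0) (op1 := +%R)).
  rewrite (big_morph _ (@scalar_ofD R s) (@scalar_of0 R s)).
  by apply: eq_bigr => m _; rewrite mulrC mulr_conj.
have a0 : 0 <= a by rewrite -za sqr_ge0.
have : a <= opnorm u * rnorm z.
  have := le_trans (rnorm_coord_c0 (u z) j) (rnorm_le_opnorm z ub).
  by rewrite uz rnorm_of ger0_norm.
have := rnorm_ge0 z; have := opnorm_ge0 ub; rewrite -za.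
by move: (rnorm z) (opnorm u) => p q q0 p0 h; nra.
Qed.

Lemma sum_gt d (f : 'I_d -> R) e : (0 < d)%N -> (forall i, e < f i) ->
  d%:R * e < \sum_i f i.
Proof.
move=> d0 ef; rewrite mulrC mulr_natr -[X in _ *+ X]card_ord -sumr_const.
by apply: ltr_sum => //; apply/hasP; exists (Ordinal d0); rewrite ?mem_index_enum.
Qed.

Variable V : {linear c0 -> l1}.
Hypothesis Vb : bounded_op V.

Let V0 : 0 <= opnorm V. Proof. exact: opnorm_ge0. Qed.

(** Orthonormality gives [A = 1]; the norming functionals have coefficients of modulus at most 1,
    which only gives [B] equal to the root of [d]. *)
Lemma weyl_approximable (u : {linear H -> c0}) d : bounded_op u -> opnorm u <= 1 ->
  (0 < d)%N -> approximable (V \o u) d (32 * opnorm V / Num.sqrt d%:R).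
Proof.
move=> ub u1 d0; set e := _ / _; have q0 : 0 < Num.sqrt d%:R :> R.
  by rewrite sqrtr_gt0 ltr0n.
have e0 : 0 <= e by rewrite divr_ge0 ?mulr_ge0 // ltW.
apply: contrapT => We.
have [x [xo xe]] := greedy_domain (bounded_comp ub Vb).1 e0 We.
have norming (i : 'I_d) : exists t : nat * (nat -> K),
    (forall k, rnorm (t.2 k) <= 1) /\
    e < scalar_re (l1_fun t.2 0 t.1 (V (u (x i))) : K).
  have [|N [c [_ c1 ec]]] := @l1_norming _ _ (V (u (x i))) 0 e e0.
    by rewrite /l1_trunc /l1_fin big_ord0 subr0 xe.
  by exists (N, c).
have [t tP] := choice norming.
have := @operator_grothendieck _ _ V Vb d (fun i => u (x i))
  (fun i => l1_fun (t i).2 0 (t i).1) 1 (Num.sqrt d%:R) ltr01 q0.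
(* [B] is the sum bounded by Grothendieck's inequality: [e] makes [d%:R * e] equal to the upper
   bound, while each summand exceeds [e]. *)
suff : forall B : R, B <= 32 * opnorm V * (1 * Num.sqrt d%:R) ->
    ~ (d%:R * e < B).
  move=> h /(_ _ _ _)/h; apply; last exact: sum_gt (fun i => (tP i).2).
  - by move=> i; exists 1 => z; apply: rnorm_l1_fun_le; exact: (tP i).1.
  - move=> j; apply: le_trans (sum_coord_le _ ub xo) _.
    by rewrite expr1n expr_le1 // opnorm_ge0.
  - move=> i; rewrite sqr_sqrtr ?ler0n //.
    apply: (@le_trans _ _ (\sum_(m < d) 1)); last by rewrite sumr_const card_ord.
    apply: ler_sum => m _; rewrite expr_le1 ?rnorm_ge0 //= l1_fun_delta.
    by case: ifP => _; [exact: (tP m).1|rewrite rnorm0].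
move=> B BV; apply/negP; rewrite -leNgt; apply: le_trans BV _.
rewrite -[X in X * e](@sqr_sqrtr _ d%:R) ?ler0n // /e mul1r expr2.
by rewrite mulrACA divff ?gt_eqF // mulr1 mulrC.
Qed.

Lemma sum_ip_le (v : {linear l1 -> H}) d (y : nat -> H) i : bounded_op v ->
  orthonormal_seq d y ->
  \sum_(m < d) rnorm (ip (v (l1_delta i)) (y m)) ^+ 2 <= opnorm v ^+ 2.
Proof.
move=> vb yo; apply: le_trans (bessel yo _) _.
rewrite ler_sqr ?nnegrE ?rnorm_ge0 ?opnorm_ge0 //.
apply: le_trans (rnorm_le_opnorm _ vb) _.
by rewrite ler_piMr ?opnorm_ge0 // rnorm_l1_delta.
Qed.

Lemma bounded_ip_fun (v : {linear l1 -> H}) d (y : nat -> H) i : bounded_op v ->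
  orthonormal_seq d y -> (i < d)%N -> bounded_op (ipr (y i) \o v).
Proof.
move=> vb yo id; exists (opnorm v) => z; apply: le_trans (rnorm_ip_le yo _ id) _.
exact: rnorm_le_opnorm.
Qed.

(** The roles are exchanged: Bessel's inequality gives [B = 1], and the unit vectors in [c0] only
    give [A] equal to the root of [d]. *)
Lemma chang_approximable (v : {linear l1 -> H}) d : bounded_op v -> opnorm v <= 1 ->
  (0 < d)%N -> approximable (v \o V) d (32 * opnorm V / Num.sqrt d%:R).
Proof.
move=> vb v1 d0; set e := _ / _; have q0 : 0 < Num.sqrt d%:R :> R.
  by rewrite sqrtr_gt0 ltr0n.
have e0 : 0 <= e by rewrite divr_ge0 ?mulr_ge0 // ltW.
apply: contrapT => We.
have [x [y [yo xye]]] := greedy_range (bounded_comp Vb vb).1 e0 We.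
have := @operator_grothendieck _ _ V Vb d (fun i => x i)
  (fun i => ipr (y i) \o v) (Num.sqrt d%:R) 1 q0 ltr01.
suff : forall B : R, B <= 32 * opnorm V * (Num.sqrt d%:R * 1) ->
    ~ (d%:R * e < B).
  move=> h /(_ _ _ _)/h; apply.
  - by move=> i; exact: bounded_ip_fun yo _.
  - move=> j; rewrite sqr_sqrtr ?ler0n //.
    apply: (@le_trans _ _ (\sum_(m < d) 1)); last by rewrite sumr_const card_ord.
    apply: ler_sum => m _; rewrite expr_le1 ?rnorm_ge0 //=.
    by apply: le_trans (rnorm_coord_c0 _ _) _; case: (xye m).
  - move=> i; apply: le_trans (sum_ip_le _ vb yo) _.
    by rewrite expr1n expr_le1 // opnorm_ge0.
  - by apply: sum_gt => // i; case: (xye i).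
move=> B BV; apply/negP; rewrite -leNgt; apply: le_trans BV _.
rewrite -[X in X * e](@sqr_sqrtr _ d%:R) ?ler0n // /e mulr1 expr2.
by rewrite mulrACA divff ?gt_eqF // mulr1 mulrC.
Qed.

Lemma hilbert_approximable (u : {linear H -> c0}) (v : {linear l1 -> H}) d :
  bounded_op u -> bounded_op v -> opnorm u * opnorm v <= 1 -> (0 < d)%N ->
  approximable (v \o V \o u) (d + d) (64 * opnorm V / d%:R).
Proof.
move=> ub vb uv1 d0; set e := _ / _; have d0' : 0 < d%:R :> R by rewrite ltr0n.
have e0 : 0 <= e by rewrite divr_ge0 ?mulr_ge0 // ltW.
apply: contrapT => We.
have [vV _] := bounded_comp Vb vb; have [vVu _] := bounded_comp ub vV.
have [x [y [xo yo xye]]] := greedy_both vVu e0 We.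
have [u0 v0] := (opnorm_ge0 ub, opnorm_ge0 vb).
(* The constants must be positive although [opnorm u] or [opnorm v] may be 0; this perturbation
   raises the product of the two norms by at most 1. *)
pose w := (1 + opnorm u + opnorm v)^-1.
have w0 : 0 < w by rewrite invr_gt0; lra.
have w1 : w * (1 + opnorm u + opnorm v) = 1 by rewrite mulVf // gt_eqF //; lra.
have A0 : 0 < opnorm u + w by lra.
have B0 : 0 < opnorm v + w by lra.
have AB : (opnorm u + w) * (opnorm v + w) <= 2 by nra.
have := @operator_grothendieck _ _ V Vb d (fun i => u (x i))
  (fun i => ipr (y i) \o v) _ _ A0 B0.
suff : forall B : R, B <= 32 * opnorm V * ((opnorm u + w) * (opnorm v + w)) ->
    ~ (d%:R * e < B).
  move=> h /(_ _ _ _)/h; apply.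
  - by move=> i; exact: bounded_ip_fun yo _.
  - by move=> j; apply: le_trans (sum_coord_le _ ub xo) _; rewrite ler_sqr ?nnegrE //; lra.
  - by move=> i; apply: le_trans (sum_ip_le _ vb yo) _; rewrite ler_sqr ?nnegrE //; lra.
  - by apply: sum_gt => // i; exact: xye.
move=> B BV; apply/negP; rewrite -leNgt; apply: le_trans BV _.
rewrite /e [leRHS]mulrC divfK ?gt_eqF //.
by rewrite (_ : 64 * _ = 32 * opnorm V * 2); [rewrite ler_wpM2l // mulr_ge0|ring].
Qed.

End SNumbers.

(** * Splitting off the finite rank truncation *)

Section Limits.
Context {R : realType} {s : scalar_kind}.
Local Notation H := (l2 R s).
Local Notation c0 := (c0 R s).
Local Notation l1 := (l1 R s).
Variable T : {linear c0 -> l1}.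
Hypothesis Tb : bounded_op T.

Lemma sup_between (A : set R) (M : R) : has_sup A ->
  (forall a, A a -> 0 <= a <= M) -> 0 <= sup A <= M.
Proof.
move=> As AM; have [[a Aa] _] := As; apply/andP; split.
  by case/andP: (AM _ Aa) => a0 _; apply: le_trans a0 _; exact: sup_upper_bound.
by apply: ge_sup; [exists a|move=> b /AM/andP[]].
Qed.

Variables (N : nat) (eta : R).
Let V : {linear c0 -> l1} := T \- (l1_trunc N \o T).
Hypothesis Veta : opnorm V <= eta.

Let Fb : bounded_op (l1_trunc N \o T).
Proof. by case: (bounded_comp Tb (bounded_l1_trunc N)). Qed.

Let Vb : bounded_op V. Proof. exact: bounded_opB. Qed.

Let TE x : T x = l1_trunc N (T x) + V x.
Proof. by rewrite /V /= addrC subrK. Qed.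

Let FN : spanned (l1_trunc N \o T) N.
Proof. exact/spanned_precomp/spanned_l1_trunc. Qed.

(** Of the [n - 1] dimensions available, [N] are spent on the truncation of [T] and [d] on
    approximating the small remainder [V] composed with [u]. *)
Lemma weyl_le d n : (0 < d)%N -> (N + d < n)%N ->
  0 <= weyl n T <= 32 * eta / Num.sqrt d%:R.
Proof.
move=> d0 Nd; have n0 : (0 < n)%N by exact: leq_ltn_trans Nd.
apply: sup_between; first exact: weyl_has_sup.
move=> _ [u [ub u1] <-]; have [Tub _] := bounded_comp ub Tb.
have /andP[-> _] /= := approx_bounds Tub n0.
apply: (@le_trans _ _ (32 * opnorm V / Num.sqrt d%:R)); last first.
  by rewrite ler_wpM2r ?invr_ge0 ?sqrtr_ge0 // ler_pM2l.
apply: (@approx_approximable _ _ _ _ _ (l1_trunc N \o T \o u) (V \o u) _ N d) => //.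
- by case: (bounded_comp ub Fb).
- exact: spanned_precomp.
- by move=> x; exact: TE.
- exact: weyl_approximable.
Qed.

Lemma chang_le d n : (0 < d)%N -> (N + d < n)%N ->
  0 <= chang n T <= 32 * eta / Num.sqrt d%:R.
Proof.
move=> d0 Nd; have n0 : (0 < n)%N by exact: leq_ltn_trans Nd.
apply: sup_between; first exact: chang_has_sup.
move=> _ [v [vb v1] <-]; have [vTb _] := bounded_comp Tb vb.
have /andP[-> _] /= := approx_bounds vTb n0.
apply: (@le_trans _ _ (32 * opnorm V / Num.sqrt d%:R)); last first.
  by rewrite ler_wpM2r ?invr_ge0 ?sqrtr_ge0 // ler_pM2l.
apply: (@approx_approximable _ _ _ _ _ (v \o (l1_trunc N \o T)) (v \o V) _ N d) => //.
- by case: (bounded_comp Fb vb).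
- exact: spanned_comp.
- by move=> x; rewrite /= -linearD -TE.
- exact: chang_approximable.
Qed.

Lemma hilbert_le d n : (0 < d)%N -> (N + (d + d) < n)%N ->
  0 <= hilbert n T <= 64 * eta / d%:R.
Proof.
move=> d0 Nd; have n0 : (0 < n)%N by exact: leq_ltn_trans Nd.
apply: sup_between; first exact: hilbert_has_sup.
move=> _ [[u v] /= [ub vb uv1] <-].
have [vTb _] := bounded_comp Tb vb; have [vTub _] := bounded_comp ub vTb.
have /andP[-> _] /= := approx_bounds vTub n0.
apply: (@le_trans _ _ (64 * opnorm V / d%:R)); last first.
  by rewrite ler_wpM2r ?invr_ge0 // ler_pM2l.
have [vFb _] := bounded_comp Fb vb.
apply: (@approx_approximable _ _ _ _ _ (v \o (l1_trunc N \o T) \o u)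
  (v \o V \o u) _ N (d + d)) => //.
- by case: (bounded_comp ub vFb).
- exact/spanned_precomp/spanned_comp.
- by move=> x; rewrite /= -linearD -TE.
- exact: hilbert_approximable.
Qed.

End Limits.

Lemma cvg_to_zero (R : realType) (f : nat -> R) (C : R) : 0 < C ->
  (forall e, 0 < e -> \forall n \near \oo, 0 <= f n <= C * e) ->
  f n @[n --> \oo] --> (0 : R).
Proof.
move=> C0 fe; apply/cvgr0Pnorm_le => e e0.
have /fe : 0 < e / C by rewrite divr_gt0.
apply: filterS => n /andP[f0 fn]; rewrite ger0_norm // (le_trans fn) //.
by rewrite mulrC divfK // gt_eqF.
Qed.

Theorem proposition1p2 (R : realType) (s : scalar_kind)
  (T : {linear c0 R s -> l1 R s}) (T_bounded : bounded_op T) :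
  [/\ Num.sqrt k%:R * weyl k T @[k --> \oo] --> (0 : R),
      Num.sqrt k%:R * chang k T @[k --> \oo] --> (0 : R) &
      k%:R * hilbert k T @[k --> \oo] --> (0 : R)].
Proof.
(* All dimensions left by the truncation are used, [d = k - N - 1]; then [k <= 4 * d], which doubles
   the constant 32. *)
have sqrt_le (x e : R) N k : 0 < e -> (2 * N + 2 <= k)%N ->
    0 <= x <= 32 * e / Num.sqrt (k - N - 1)%:R ->
    0 <= Num.sqrt k%:R * x <= 64 * e.
  move=> e0 kN /andP[x0 xe]; rewrite mulr_ge0 ?sqrtr_ge0 //=.
  have q0 : 0 < Num.sqrt (k - N - 1)%:R :> R by rewrite sqrtr_gt0 ltr0n; lia.
  rewrite ler_pdivlMr // in xe.
  have kq : Num.sqrt k%:R <= 2 * Num.sqrt (k - N - 1)%:R :> R.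
    rewrite -ler_sqr ?nnegrE ?mulr_ge0 ?sqrtr_ge0 // exprMn !sqr_sqrtr //.
    by rewrite -natrX -natrM ler_nat; lia.
  by apply: (@le_trans _ _ (2 * Num.sqrt (k - N - 1)%:R * x));
    [rewrite ler_wpM2r|lra].
split.
- apply: (@cvg_to_zero _ _ 64) => // e e0.
  have [N Ne] := opnorm_sub_trunc_small T_bounded e0.
  exists (2 * N + 2)%N => // k /= Nk; apply: (sqrt_le _ e N) => //.
  by apply: (weyl_le T_bounded Ne); lia.
- apply: (@cvg_to_zero _ _ 64) => // e e0.
  have [N Ne] := opnorm_sub_trunc_small T_bounded e0.
  exists (2 * N + 2)%N => // k /= Nk; apply: (sqrt_le _ e N) => //.
  by apply: (chang_le T_bounded Ne); lia.
apply: (@cvg_to_zero _ _ 512) => // e e0.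
have [N Ne] := opnorm_sub_trunc_small T_bounded e0.
(* Rank [d + d] has to fit into [k - N - 1], hence the half; [k <= 8 * d] then turns 64 into 512. *)
exists (2 * N + 8)%N => // k /= Nk; pose d := (k - N - 1)./2.
have d0 : (0 < d)%N by rewrite /d; lia.
have Nd : (N + (d + d) < k)%N by rewrite /d; lia.
have kd : (k <= 8 * d)%N by rewrite /d; lia.
have /andP[h0 hle] := hilbert_le T_bounded Ne d0 Nd.
rewrite mulr_ge0 //= (le_trans (_ : _ <= (8 * d)%:R * hilbert k T)) //.
  by rewrite ler_wpM2r // ler_nat.
by rewrite ler_pdivlMr ?ltr0n // in hle; rewrite natrM; lra.
Qed.
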